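(* Let $\mathcal{D}$ be a qualification domain expressible in a constraint domain $\mathcal{C}$, let $\mathcal{P}$ be a $\mathrm{QCFLP}(\mathcal{D},\mathcal{C})$-program with transformed program $\mathcal P^{\mathcal T}$, and let $G = (\delta_i\sharp W_i,\ W_i \trianglerighteq \beta_i)_{i=1\dots m}$ be a goal for $\mathcal{P}$ with transformed goal $G^{\mathcal T}$. Let $\sigma$ be a substitution (on $\mathcal V\!ar$), $\mu$ a $\mathcal D$-valuation (on qualification variables, defined on $W_1,\dots,W_m$), and $\Pi$ a finite set of atomic primitive $\mathcal C$-constraints. Then the following two statements are equivalent: 1. $\langle \sigma,\mu,\Pi \rangle \in \mathrm{Sol}_{\mathcal{P}}(G)$. 2. $\langle \sigma \uplus \mu \uplus \rho,\ \Pi \rangle \in \mathrm{Sol}_{\mathcal{P}^{\mathcal T}}(G^{\mathcal T})$ for some $\mathcal D$-valuation $\rho$ such that $\mathrm{vdom}(\rho)$ is the set of new (fresh) qualification variables introduced by the transformation of $G$.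
   Context: **Qualification domain.** $\mathcal{D} = \langle D, \trianglelefteq, \mathbf{b}, \mathbf{t}, \circ\rangle$ where $\langle D,\trianglelefteq,\mathbf b,\mathbf t\rangle$ is a lattice with bottom $\mathbf b$, top $\mathbf t$, meet $\sqcap$, and $\circ: D\times D\to D$ satisfies: $\circ$ is associative, commutative and monotonic w.r.t. $\trianglelefteq$; $d\circ \mathbf t = d$ for all $d$; $d\circ e \trianglelefteq e$ and $d\circ e\neq e$ for all $d,e\in D\setminus\{\mathbf b,\mathbf t\}$; $d\circ(e_1\sqcap e_2) = (d\circ e_1)\sqcap(d\circ e_2)$. **Syntax.** A signature $\Sigma=\langle DC,PF,DF\rangle$ consists of mutually disjoint sets of data constructors, primitive function symbols and defined function symbols, ranked by arities ($DC^n$, $PF^n$, $DF^n$); it includes $true,false\in DC^0$ and the infix symbol $==\ \in PF^2$. Given a set $B$ of basic values and a countably infinite set $\mathcal V\!ar$ of variables: expressions are $e::=\bot\mid X\mid u\mid h(e_1,\dots,e_n)$ with $X\in\mathcal V\!ar$, $u\in B$, $h\in DC^n\cup PF^n\cup DF^n$; terms are $t::=\bot\mid X\mid u\mid c(t_1,\dots,t_n)$ with $c\in DC^n$. An expression or term is total if it has no occurrence of $\bot$, ground if it has no variables. The information ordering $\sqsubseteq$ is the least partial order on expressions compatible with contexts such that $\bot\sqsubseteq e$ for all $e$. Substitutions map variables to (possibly partial) terms; $o\sigma$ is the result of applying $\sigma$ to $o$; $\mathrm{vdom}(\sigma)$ is the domain of $\sigma$; $\uplus$ is the union of substitutions with disjoint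 domains. **Constraint domain.** $\mathcal C=\langle C,\{p^{\mathcal C}\mid p\in PF\}\rangle$ of signature $\Sigma$: $C$ is the set of ground terms over some set $B=B_{\mathcal C}$ of basic values; for $p\in PF^n$, $p^{\mathcal C}\subseteq C^n\times C$, written $p^{\mathcal C}(\overline t_n)\to t$. Monotonicity: if $p^{\mathcal C}(\overline t_n)\to t$, $t_i\sqsubseteq t_i'$ for all $i$ and $t\sqsupseteq t'$, then $p^{\mathcal C}(\overline{t'}_n)\to t'$. Radicality: if $p^{\mathcal C}(\overline t_n)\to t$ then $t=\bot$ or $t\in B\cup DC^0$. The symbol $==$ is interpreted as strict equality: $(t_1 ==^{\mathcal C} t_2)\to t$ iff $t=\bot$, or $t=true$ and $t_1=t_2$ is total, or $t=false$ and $t_1,t_2$ have no common upper bound w.r.t. $\sqsubseteq$. **Constraints.** Atomic constraints have the form $p(\overline e_n)==v$ with $p\in PF^n$, $e_i$ expressions, $v$ a variable or in $DC^0\cup B_{\mathcal C}$; they are primitive if no $DF$ symbol occurs. For ground expressions without $DF$ symbols define $e\rightsquigarrow t$ ($t\in C$) inductively: $e\rightsquigarrow\bot$; $u\rightsquigarrow u$ for $u\in B$; $c(\overline e_n)\rightsquigarrow c(\overline t_n)$ if all $e_i\rightsquigarrow t_i$; $p(\overline e_n)\rightsquigarrow t$ if all $e_i\rightsquigarrow t_i$ and $p^{\mathcal C}(\overline t_n)\to t$. A ground primitive $p(\overline e_n)==t$ is true iff $t$ is total and $p(\overline e_n)\rightsquigarrow t$. A valuation is a substitution $\eta$ with $X\eta\in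 C$ for all $X\in\mathrm{vdom}(\eta)$. For a set $\Pi$ of primitive constraints (read as a conjunction), $\mathrm{Sol}_{\mathcal C}(\Pi)$ is the set of valuations $\eta$ such that $\pi\eta$ is ground and true for all $\pi\in\Pi$; $\mathrm{Unsat}_{\mathcal C}(\Pi)$ means $\mathrm{Sol}_{\mathcal C}(\Pi)=\emptyset$; $\Pi\models_{\mathcal C}\pi$ means every valuation defined on all variables involved that solves $\Pi$ solves $\pi$; $\Pi\models_{\mathcal C}p(\overline t_n)\to v$ means that $p^{\mathcal C}(\overline t_n\eta)\to v\eta$ for every such solution $\eta$ of $\Pi$. **Expressibility.** $\mathcal D$ is expressible in $\mathcal C$ if $D\setminus\{\mathbf b\}\subseteq C$ and there are primitive $\mathcal C$-constraints (conjunctions of atomic ones) $\mathsf{qVal}(X)$, depending on $X$, whose solutions are exactly the valuations $\eta$ with $\eta(X)\in D\setminus\{\mathbf b\}$, and $\mathsf{qBound}(X,Y,Z)$, depending on $X,Y,Z$, such that for all $\eta$ with $\eta(X),\eta(Y),\eta(Z)\in D\setminus\{\mathbf b\}$: $\eta$ solves it iff $\eta(X)\trianglelefteq\eta(Y)\circ\eta(Z)$. Write $\ulcorner X\trianglelefteq Y\circ Z\urcorner$ for $\mathsf{qBound}(X,Y,Z)$, $\ulcorner X\trianglelefteq Y\urcorner$ for $\mathsf{qBound}(X,\mathbf t,Y)$ and $\ulcorner X\trianglerighteq Y\urcorner$ for $\mathsf{qBound}(Y,\mathbf t,X)$ (arguments may be variables or values). A conjunction occurring as a condition or in a goal stands for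 the sequence of its atomic members. A $\mathcal D$-valuation is a valuation $\mu$ with $X\mu\in D\setminus\{\mathbf b\}$ for all $X\in\mathrm{vdom}(\mu)$. **Source programs and statements.** A $\mathrm{QCFLP}(\mathcal D,\mathcal C)$-program is a set of rules $f(\overline t_n)\xrightarrow{\alpha} r\Leftarrow\delta_1,\dots,\delta_m$ with $f\in DF^n$, $\overline t_n$ a linear tuple of terms, $\alpha\in D\setminus\{\mathbf b\}$, $r$ an expression, $\delta_j$ atomic constraints, and no occurrence of $\bot$. A qc-statement is $\psi\sharp d\Leftarrow\Pi$ with $d\in D\setminus\{\mathbf b\}$, $\Pi$ a finite set of atomic primitive constraints, and $\psi$ either a production $e\to t$ ($e$ expression, $t$ term) or an atomic constraint; it is trivial iff $\mathrm{Unsat}_{\mathcal C}(\Pi)$ or $\psi$ is $e\to\bot$. **Logic $\mathrm{QCRWL}(\mathcal D,\mathcal C)$.** $\mathcal P\vdash_{\mathcal D,\mathcal C}\varphi$ means $\varphi$ is derivable by the following rules (all $d$'s in $D\setminus\{\mathbf b\}$), where trivial statements can be inferred only by QTI: - QTI: infer any trivial $\varphi$. - QRR: infer $(v\to v)\sharp d\Leftarrow\Pi$ if $v\in\mathcal V\!ar\cup B_{\mathcal C}$. - QDC: from $(e_i\to t_i)\sharp d_i\Leftarrow\Pi$ ($1\le i\le n$) infer $(c(\overline e_n)\to c(\overline t_n))\sharp d\Leftarrow\Pi$ if $c\in DC^n$, $d\trianglelefteq d_i$ for all $i$. - QDF$_{\mathcal P}$: from $(e_i\to t_i)\sharp d_i\Leftarrow\Pi$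 ($1\le i\le n$), $(r\to t)\sharp d_0'\Leftarrow\Pi$ and $\delta_j\sharp d_j'\Leftarrow\Pi$ ($1\le j\le m$) infer $(f(\overline e_n)\to t)\sharp d\Leftarrow\Pi$ if $f\in DF^n$, $(f(\overline t_n)\xrightarrow{\alpha}r\Leftarrow\delta_1,\dots,\delta_m)\in[\mathcal P]_\bot=\{R\theta\mid R\in\mathcal P,\ \theta\text{ a substitution}\}$, $d\trianglelefteq d_i$ ($1\le i\le n$), $d\trianglelefteq\alpha\circ d_j'$ ($0\le j\le m$). - QPF: from $(e_i\to t_i)\sharp d_i\Leftarrow\Pi$ ($1\le i\le n$) infer $(p(\overline e_n)\to v)\sharp d\Leftarrow\Pi$ if $p\in PF^n$, $v\in\mathcal V\!ar\cup DC^0\cup B_{\mathcal C}$, $\Pi\models_{\mathcal C}p(\overline t_n)\to v$, $d\trianglelefteq d_i$ for all $i$. - QAC: from the same premises infer $(p(\overline e_n)==v)\sharp d\Leftarrow\Pi$ if $p\in PF^n$, $v\in\mathcal V\!ar\cup DC^0\cup B_{\mathcal C}$, $\Pi\models_{\mathcal C}p(\overline t_n)==v$, $d\trianglelefteq d_i$ for all $i$. **Target language $\mathrm{CFLP}(\mathcal C)$ and logic $\mathrm{CRWL}(\mathcal C)$.** The target signature $\Sigma'$ replaces each $f\in DF^n$ by a symbol $f'\in DF^{n+1}$ and keeps all other symbols. Target variables are $\mathcal V\!ar\cup\mathcal W\!ar$, where $\mathcal W\!ar$ is a countable set of qualification variables disjoint from $\mathcal V\!ar$ and $\Sigma$. Program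 rules have the form $f(\overline t_n)\to r\Leftarrow\Delta$ (no attenuation factors); c-statements are $e\to t\Leftarrow\Pi$ (trivial iff $t=\bot$ or $\mathrm{Unsat}_{\mathcal C}(\Pi)$) and $\delta\Leftarrow\Pi$ (trivial iff $\mathrm{Unsat}_{\mathcal C}(\Pi)$). $\vdash_{\mathcal C}$ is derivability by the rules TI, RR, DC, DF$_{\mathcal P}$, PF, AC, obtained from QTI, QRR, QDC, QDF$_{\mathcal P}$, QPF, QAC respectively by erasing all qualification values, attenuation factors and the side conditions on them (over target variables and signature). **Goals and solutions.** A goal $G$ for a $\mathrm{QCFLP}(\mathcal D,\mathcal C)$-program $\mathcal P$ has the form $\delta_1\sharp W_1,\dots,\delta_m\sharp W_m$ together with threshold conditions $W_1\trianglerighteq\beta_1,\dots,W_m\trianglerighteq\beta_m$, abbreviated $(\delta_i\sharp W_i,\ W_i\trianglerighteq\beta_i)_{i=1\dots m}$, where $\delta_i$ are atomic $\mathcal C$-constraints, $W_i\in\mathcal W\!ar$ are pairwise different, $\beta_i\in D\setminus\{\mathbf b\}$. $\mathrm{Sol}_{\mathcal P}(G)$ is the set of triples $\langle\sigma,\mu,\Pi\rangle$ with $\sigma$ a substitution, $\mu$ a $\mathcal D$-valuation, $\Pi$ a finite set of atomic primitive $\mathcal C$-constraints such that for all $1\le i\le m$: $W_i\mu=d_i\trianglerighteq\beta_i$ and $\mathcal P\vdash_{\mathcal D,\mathcal C}(\delta_i\sigma)\sharp d_i\Leftarrow\Pi$. A goal for a $\mathrm{CFLP}(\mathcal C)$-program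 $\mathcal P'$ is a sequence $\delta_1,\dots,\delta_k$ of atomic constraints, and $\mathrm{Sol}_{\mathcal P'}$ of it is the set of pairs $\langle\sigma,\Pi\rangle$ with $\sigma$ a substitution, $\Pi$ a finite set of atomic primitive constraints, and $\mathcal P'\vdash_{\mathcal C}\delta_j\sigma\Leftarrow\Pi$ for $1\le j\le k$. **Transformation.** Qualification variables introduced as ''fresh'' are pairwise distinct elements of $\mathcal W\!ar$, different from all qualification variables already in use. - Expressions, $e^{\mathcal T}=(e',\Omega,\mathcal W)$: $v^{\mathcal T}=(v,\emptyset,\emptyset)$ for $v\in\mathcal V\!ar\cup B_{\mathcal C}$ and for $v=\bot$. If $e_i^{\mathcal T}=(e_i',\Omega_i,\mathcal W_i)$ ($1\le i\le n$): for $h\in DC^n\cup PF^n$, $h(\overline e_n)^{\mathcal T}=(h(\overline{e'}_n),\bigcup_i\Omega_i,\bigcup_i\mathcal W_i)$; for $f\in DF^n$, $f(\overline e_n)^{\mathcal T}=(f'(\overline{e'}_n,W),\Omega',\{W\})$ with $W$ fresh and $\Omega'=\bigcup_i\Omega_i\cup\{\mathsf{qVal}(W)\}\cup\{\ulcorner W\trianglelefteq W'\urcorner\mid W'\in\bigcup_i\mathcal W_i\}$. - Atomic constraints: $(p(\overline e_n)==v)^{\mathcal T}=(p(\overline{e'}_n)==v,\bigcup_i\Omega_i,\bigcup_i\mathcal W_i)$ if $e_i^{\mathcal T}=(e_i',\Omega_i,\mathcal W_i)$. - Rules: if $r^{\mathcal T}=(r',\Omega_r,\mathcal W_r)$ and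 $\delta_i^{\mathcal T}=(\delta_i',\Omega_i,\mathcal W_i)$, then $(f(\overline t_n)\xrightarrow{\alpha}r\Leftarrow\delta_1,\dots,\delta_m)^{\mathcal T}$ is the rule $f'(\overline t_n,W)\to r'\Leftarrow\mathsf{qVal}(W),\,\Omega_r,\,(\ulcorner W\trianglelefteq\alpha\circ W'\urcorner)_{W'\in\mathcal W_r},\,(\Omega_i,(\ulcorner W\trianglelefteq\alpha\circ W'\urcorner)_{W'\in\mathcal W_i},\delta_i')_{i=1\dots m}$ with $W$ fresh, where a family $(\ulcorner W\trianglelefteq\alpha\circ W'\urcorner)_{W'\in\mathcal W'}$ with $\mathcal W'=\emptyset$ is understood as the single constraint $\ulcorner W\trianglelefteq\alpha\urcorner$. $\mathcal P^{\mathcal T}$ is the set of transforms of all rules of $\mathcal P$. - Goals: if $\delta_i^{\mathcal T}=(\delta_i',\Omega_i',\mathcal W_i')$, then $G^{\mathcal T}=(\Omega_i',\ \mathsf{qVal}(W_i),\ (\ulcorner W_i\trianglelefteq W'\urcorner)_{W'\in\mathcal W_i'},\ \ulcorner W_i\trianglerighteq\beta_i\urcorner,\ \delta_i')_{i=1\dots m}$, where the family is understood as $\ulcorner W_i\trianglelefteq\mathbf t\urcorner$ if $\mathcal W_i'=\emptyset$.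
   Formalization: The formal theorem additionally assumes that if Π is unsatisfiable then W_iμ ⊵ β_i for all i; without this the claim fails, since for unsatisfiable Π statement 2 holds trivially while statement 1 still demands the thresholds. *)

(* Defs.v *)
From Stdlib Require List.
From mathcomp Require Import all_boot all_order.

Set Implicit Arguments.
Unset Strict Implicit.
Unset Printing Implicit Defensive.

Import Order.TTheory.
Local Open Scope order_scope.

(* Tuples of arguments are functions on 'I_n, so that Leibniz equality of     *)
(* expressions is the intended one under functional extensionality.           *)

(* The part of a signature shared by sources, targets and constraint domains. *)
(* DF n, the defined function symbols of arity n, is a separate parameter,    *)
(* because it is the only part changed by the transformation.  Disjointness   *)
(* of the symbol sets is ensured by the constructors of [expr].               *)
Record signature := Signature {
  DC : nat -> Type;
  PF : nat -> Type;
  c_true : DC 0;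
  c_false : DC 0;
  true_neq_false : c_true <> c_false;
  p_eq : PF 2 }.

Definition noDF (n : nat) : Type := void.

(* Concatenation s_0 ++ ... ++ s_(n-1); it also renders finite unions.        *)
Definition bigcat T n (s : 'I_n -> seq T) : seq T :=
  flatten [seq s i | i <- enum 'I_n].

(* The tuple (a_0, ..., a_(n-1), x).                                          *)
Definition snoc T n (a : 'I_n -> T) (x : T) : 'I_n.+1 -> T :=
  fun i => if unlift ord_max i is Some j then a j else x.

Section Syntax.
Context (S : signature) (B : Type).

Inductive term (V : Type) : Type :=
| TBot
| TVar of V
| TBas of B
| TCon n of DC S n & ('I_n -> term V).

Inductive expr (F : nat -> Type) (V : Type) : Type :=
| EBot
| EVar of V
| EBas of B
| ECon n of DC S n & ('I_n -> expr F V)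
| EPrim n of PF S n & ('I_n -> expr F V)
| EDef n of F n & ('I_n -> expr F V).

(* p(e_1, ..., e_n) == v; any term is allowed as v, so that constraints are   *)
(* closed under substitutions; see [atomic] for the restriction on v.         *)
Record constr (F : nat -> Type) (V : Type) := Constr {
  c_ar : nat;
  c_pf : PF S c_ar;
  c_args : 'I_c_ar -> expr F V;
  c_rhs : term V }.
#[global] Arguments c_args {F V} _ _.

Inductive stmt (F : nat -> Type) (V : Type) : Type :=
| Prod of expr F V & term V
| Con of constr F V.

Fixpoint expr_of_term F V (t : term V) : expr F V :=
  match t with
  | TBot => EBot F V
  | TVar x => EVar F x
  | TBas u => EBas F V u
  | TCon n c ts => ECon c (fun i => expr_of_term F (ts i))
  end.

Fixpoint expr_of_prim F V (e : expr noDF V) : expr F V :=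
  match e with
  | EBot => EBot F V
  | EVar x => EVar F x
  | EBas u => EBas F V u
  | ECon n c es => ECon c (fun i => expr_of_prim F (es i))
  | EPrim n p es => EPrim p (fun i => expr_of_prim F (es i))
  | EDef n f _ => match f with end
  end.

Definition constr_of_prim F V (c : constr noDF V) : constr F V :=
  Constr (c_pf c) (fun i => expr_of_prim F (c_args c i)) (c_rhs c).

Fixpoint tsubst V V' (s : V -> term V') (t : term V) : term V' :=
  match t with
  | TBot => TBot V'
  | TVar x => s x
  | TBas u => TBas V' u
  | TCon n c ts => TCon c (fun i => tsubst s (ts i))
  end.

Fixpoint esubst F V V' (s : V -> term V') (e : expr F V) : expr F V' :=
  match e with
  | EBot => EBot F V'
  | EVar x => expr_of_term F (s x)
  | EBas u => EBas F V' u
  | ECon n c es => ECon c (fun i => esubst s (es i))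
  | EPrim n p es => EPrim p (fun i => esubst s (es i))
  | EDef n f es => EDef f (fun i => esubst s (es i))
  end.

Definition csubst F V V' (s : V -> term V') (c : constr F V) : constr F V' :=
  Constr (c_pf c) (fun i => esubst s (c_args c i)) (tsubst s (c_rhs c)).

Fixpoint tvars V (t : term V) : seq V :=
  match t with
  | TVar x => [:: x]
  | TCon n c ts => bigcat (fun i => tvars (ts i))
  | _ => [::]
  end.

Fixpoint evars F V (e : expr F V) : seq V :=
  match e with
  | EVar x => [:: x]
  | ECon n _ es | EPrim n _ es | EDef n _ es => bigcat (fun i => evars (es i))
  | _ => [::]
  end.

Definition cvars F V (c : constr F V) : seq V :=
  bigcat (fun i => evars (c_args c i)) ++ tvars (c_rhs c).

Fixpoint ttotal V (t : term V) : Prop :=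
  match t with
  | TBot => False
  | TCon n c ts => forall i, ttotal (ts i)
  | _ => True
  end.

Fixpoint etotal F V (e : expr F V) : Prop :=
  match e with
  | EBot => False
  | ECon n _ es | EPrim n _ es | EDef n _ es => forall i, etotal (es i)
  | _ => True
  end.

Definition ctotal F V (c : constr F V) : Prop :=
  (forall i, etotal (c_args c i)) /\ ttotal (c_rhs c).

Definition is_simple V (v : term V) : bool :=
  match v with
  | TBot => false
  | TVar _ | TBas _ => true
  | TCon n _ _ => n == 0%N
  end.

Definition is_var_or_basic V (v : term V) : bool :=
  match v with TVar _ | TBas _ => true | _ => false end.

Definition atomic F V (c : constr F V) : bool := is_simple (c_rhs c).

Definition stmt_wf F V (psi : stmt F V) : bool :=
  if psi is Con c then atomic c else true.

(* The information ordering, as the least preorder compatible with contexts   *)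
(* such that bot is below every term (its antisymmetry is a consequence).     *)
Inductive tle V : term V -> term V -> Prop :=
| tle_bot t : tle (TBot V) t
| tle_refl t : tle t t
| tle_trans t1 t2 t3 : tle t1 t2 -> tle t2 t3 -> tle t1 t3
| tle_con n (c : DC S n) ts ts' :
    (forall i, tle (ts i) (ts' i)) -> tle (TCon c ts) (TCon c ts').

(* Ground terms are the terms over the empty set of variables.                *)
Definition gterm := term void.

Definition of_void_term V (x : void) : term V := match x with end.
Definition of_gterm V (g : gterm) : term V := tsubst (@of_void_term V) g.

Definition subst V := V -> term V.

Definition vdom (V : eqType) (s : subst V) : pred V :=
  fun x => if s x is TVar y then y != x else true.

(* Meant for substitutions with disjoint domains.                             *)
Definition subst_union (V : eqType) (s1 s2 : subst V) : subst V :=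
  fun x => if vdom s1 x then s1 x else s2 x.

Definition trename V V' (f : V -> V') : term V -> term V' :=
  tsubst (fun x => TVar (f x)).
Definition crename F V V' (f : V -> V') : constr F V -> constr F V' :=
  csubst (fun x => TVar (f x)).

(* The union of a substitution on V1 and a substitution on V2.                *)
Definition subst_sum V1 V2 (s1 : subst V1) (s2 : subst V2) : subst (V1 + V2) :=
  fun x => match x with
           | inl y => trename inl (s1 y)
           | inr y => trename inr (s2 y)
           end.

End Syntax.

Arguments c_args {S B F V} _ _.
Arguments TBot {S B V}.
Arguments TVar {S B V}.
Arguments TBas {S B V}.
Arguments TCon {S B V n}.
Arguments EBot {S B F V}.
Arguments EVar {S B F V}.
Arguments EBas {S B F V}.
Arguments ECon {S B F V n}.
Arguments EPrim {S B F V n}.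
Arguments EDef {S B F V n}.
Arguments Constr {S B F V c_ar}.
Arguments Prod {S B F V}.
Arguments Con {S B F V}.
Arguments expr_of_term {S B F V}.
Arguments constr_of_prim {S B F V}.
Arguments of_gterm {S B V}.

(* The constant c, for c of arity 0.                                          *)
Definition tconst (S : signature) B V (c : DC S 0) : term S B V :=
  TCon c (fun _ => TBot).

Record cdomain (S : signature) := CDomain {
  basic : Type;
  interp : forall n, PF S n -> ('I_n -> gterm S basic) -> gterm S basic -> Prop;
  interp_monotone : forall n (p : PF S n) ts ts' t t',
    interp p ts t -> (forall i, tle (ts i) (ts' i)) -> tle t' t ->
    interp p ts' t';
  interp_radical : forall n (p : PF S n) ts t,
    interp p ts t -> t = TBot \/ is_simple t;
  interp_eq : forall ts t,
    interp (p_eq S) ts t <->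
    [\/ t = TBot,
        [/\ t = tconst basic void (c_true S),
            ts ord0 = ts ord_max & ttotal (ts ord0)]
      | t = tconst basic void (c_false S) /\
        ~ (exists u, tle (ts ord0) u /\ tle (ts ord_max) u)] }.

Notation prim_constr C V := (constr _ (basic C) noDF V).

Section Constraints.
Context (S : signature) (C : cdomain S).
Local Notation term := (term S (basic C)).
Local Notation gterm := (gterm S (basic C)).
Local Notation pconstr := (constr S (basic C) noDF).
Local Notation subst := (subst S (basic C)).

Inductive eval : expr S (basic C) noDF void -> gterm -> Prop :=
| eval_bot e : eval e TBot
| eval_bas u : eval (EBas u) (TBas u)
| eval_con n (c : DC S n) es ts :
    (forall i, eval (es i) (ts i)) -> eval (ECon c es) (TCon c ts)
| eval_prim n (p : PF S n) es ts t :
    (forall i, eval (es i) (ts i)) -> interp p ts t -> eval (EPrim p es) t.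

Definition ctrue (c : pconstr void) : Prop :=
  ttotal (c_rhs c) /\ eval (EPrim (c_pf c) (c_args c)) (c_rhs c).

Definition valuation (V : eqType) (eta : subst V) : Prop :=
  forall x, vdom eta x -> exists g : gterm, eta x = of_gterm g.

Definition solves V (eta : subst V) (c : pconstr V) : Prop :=
  exists2 c0 : pconstr void,
    csubst eta c = csubst (@of_void_term S (basic C) V) c0 & ctrue c0.

(* Finite sets of constraints are rendered by sequences.                      *)
Definition Sol (V : eqType) (Pi : seq (pconstr V)) (eta : subst V)
    : Prop :=
  valuation eta /\ forall c, List.In c Pi -> solves eta c.

Definition Unsat (V : eqType) (Pi : seq (pconstr V)) : Prop :=
  forall eta, ~ Sol Pi eta.

Definition defined_on (V : eqType) (eta : subst V)
    (Pi : seq (pconstr V)) : Prop :=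
  forall c, List.In c Pi -> {subset cvars c <= vdom eta}.

Definition entails (V : eqType) (Pi : seq (pconstr V)) (c : pconstr V) : Prop :=
  forall eta, defined_on eta (c :: Pi) -> Sol Pi eta -> solves eta c.

Definition prim_app V n (p : PF S n) (ts : 'I_n -> term V) (v : term V)
    : pconstr V :=
  Constr p (fun i => expr_of_term (ts i)) v.

(* Pi |= p(ts) -> v.                                                          *)
Definition entails_prod (V : eqType) (Pi : seq (pconstr V)) n (p : PF S n)
    (ts : 'I_n -> term V) (v : term V) : Prop :=
  forall eta, defined_on eta (prim_app p ts v :: Pi) -> Sol Pi eta ->
    exists gs (g : gterm),
      [/\ forall i, tsubst eta (ts i) = of_gterm (gs i),
          tsubst eta v = of_gterm g & interp p gs g].

Definition trivial F (V : eqType) (Pi : seq (pconstr V))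
    (psi : stmt S (basic C) F V) : Prop :=
  Unsat Pi \/ exists e, psi = Prod e TBot.

End Constraints.

Record is_qdomain (disp : Order.disp_t) (D : tbLatticeType disp)
    (circ : D -> D -> D) : Prop := IsQDomain {
  circA : associative circ;
  circC : commutative circ;
  circ_monotone : forall d d' e e', d <= d' -> e <= e' ->
    circ d e <= circ d' e';
  circ_top : forall d, circ d \top = d;
  circ_decr : forall d e,
    d != \bot -> d != \top -> e != \bot -> e != \top ->
    circ d e <= e /\ circ d e != e;
  circ_meet : forall d e1 e2,
    circ d (e1 `&` e2) = circ d e1 `&` circ d e2 }.

(* Expressibility data.  [qterm] renders the inclusion of D \ {b} in the set  *)
(* of ground terms (its value at the bottom is irrelevant); [qval] and        *)
(* [qbound] are the conjunctions qVal(X) and qBound(X,Y,Z), whose variables   *)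
(* are the elements of unit and of 'I_3, in this order.                       *)
Record expressible (disp : Order.disp_t) (D : tbLatticeType disp)
    (circ : D -> D -> D) (S : signature) (C : cdomain S) := Expressible {
  qterm : D -> gterm S (basic C);
  qterm_inj : forall d e, d != \bot -> e != \bot -> qterm d = qterm e -> d = e;
  qval : seq (constr S (basic C) noDF unit);
  qval_atomic : all (fun c => atomic c) qval;
  qval_spec : forall eta, valuation eta ->
    (Sol qval eta <-> exists2 d, d != \bot & eta tt = of_gterm (qterm d));
  qbound : seq (constr S (basic C) noDF 'I_3);
  qbound_atomic : all (fun c => atomic c) qbound;
  qbound_spec : forall eta x y z,
    valuation eta -> x != \bot -> y != \bot -> z != \bot ->
    eta (inord 0) = of_gterm (qterm x) ->
    eta (inord 1) = of_gterm (qterm y) ->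
    eta (inord 2) = of_gterm (qterm z) ->
    (Sol qbound eta <-> x <= circ y z) }.

Section QCRWL.
Context (disp : Order.disp_t) (D : tbLatticeType disp) (circ : D -> D -> D).
Context (S : signature) (C : cdomain S) (F : nat -> Type) (V : eqType).
Local Notation term := (term S (basic C) V).
Local Notation expr := (expr S (basic C) F V).
Local Notation constr := (constr S (basic C) F V).

(* f(q_lhs) --q_att--> q_rhs <= q_cond_0, ..., q_cond_(m-1)                    *)
Record qrule := QRule {
  q_ar : nat;
  q_fun : F q_ar;
  q_lhs : 'I_q_ar -> term;
  q_att : D;
  q_rhs : expr;
  q_m : nat;
  q_cond : 'I_q_m -> constr }.
#[global] Arguments q_lhs _ _ : clear implicits.
#[global] Arguments q_cond _ _ : clear implicits.

Definition qrule_wf (R : qrule) : Prop :=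
  [/\ uniq (bigcat (fun i => tvars (q_lhs R i))),
      q_att R != \bot,
      forall i, ttotal (q_lhs R i),
      etotal (q_rhs R)
    & forall j, atomic (q_cond R j) /\ ctotal (q_cond R j)].

Definition qprogram_wf (P : qrule -> Prop) : Prop :=
  forall R, P R -> qrule_wf R.

Definition qrule_subst (th : subst S (basic C) V) (R : qrule) : qrule :=
  QRule (q_fun R) (fun i => tsubst th (q_lhs R i)) (q_att R)
        (esubst th (q_rhs R)) (fun j => csubst th (q_cond R j)).

(* [P]_bot                                                                    *)
Definition qinstances (P : qrule -> Prop) (R : qrule) : Prop :=
  exists2 R0, P R0 & exists th, R = qrule_subst th R0.

(* qcrwl P Pi psi d: the qc-statement psi # d <= Pi is derivable from P.      *)
Inductive qcrwl (P : qrule -> Prop) (Pi : seq (prim_constr C V)) :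
    stmt S (basic C) F V -> D -> Prop :=
| QTI psi d :
    d != \bot -> stmt_wf psi -> trivial Pi psi -> qcrwl P Pi psi d
| QRR v d :
    d != \bot -> ~ trivial Pi (Prod (expr_of_term v : expr) v) ->
    is_var_or_basic v ->
    qcrwl P Pi (Prod (expr_of_term v) v) d
| QDC n (c : DC S n) es ts ds d :
    d != \bot -> ~ trivial Pi (Prod (ECon c es : expr) (TCon c ts)) ->
    (forall i, qcrwl P Pi (Prod (es i) (ts i)) (ds i)) ->
    (forall i, d <= ds i) ->
    qcrwl P Pi (Prod (ECon c es) (TCon c ts)) d
| QDF (R : qrule) (es : 'I_(q_ar R) -> expr) (t : term) ds d0 ds' d :
    d != \bot -> ~ trivial Pi (Prod (EDef (q_fun R) es) t) ->
    qinstances P R ->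
    (forall i, qcrwl P Pi (Prod (es i) (q_lhs R i)) (ds i)) ->
    qcrwl P Pi (Prod (q_rhs R) t) d0 ->
    (forall j, qcrwl P Pi (Con (q_cond R j)) (ds' j)) ->
    (forall i, d <= ds i) ->
    d <= circ (q_att R) d0 ->
    (forall j, d <= circ (q_att R) (ds' j)) ->
    qcrwl P Pi (Prod (EDef (q_fun R) es) t) d
| QPF n (p : PF S n) es ts v ds d :
    d != \bot -> ~ trivial Pi (Prod (EPrim p es : expr) v) ->
    (forall i, qcrwl P Pi (Prod (es i) (ts i)) (ds i)) ->
    is_simple v -> entails_prod Pi p ts v ->
    (forall i, d <= ds i) ->
    qcrwl P Pi (Prod (EPrim p es) v) d
| QAC n (p : PF S n) es ts v ds d :
    d != \bot -> ~ trivial Pi (Con (Constr p es v : constr)) ->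
    (forall i, qcrwl P Pi (Prod (es i) (ts i)) (ds i)) ->
    is_simple v -> entails Pi (prim_app p ts v) ->
    (forall i, d <= ds i) ->
    qcrwl P Pi (Con (Constr p es v)) d.

End QCRWL.

Section CRWL.
Context (S : signature) (C : cdomain S) (F : nat -> Type) (V : eqType).
Local Notation term := (term S (basic C) V).
Local Notation expr := (expr S (basic C) F V).
Local Notation constr := (constr S (basic C) F V).

Record crule := CRule {
  r_ar : nat;
  r_fun : F r_ar;
  r_lhs : 'I_r_ar -> term;
  r_rhs : expr;
  r_conds : seq constr }.
#[global] Arguments r_lhs _ _ : clear implicits.

Definition crule_subst (th : subst S (basic C) V) (R : crule) : crule :=
  CRule (r_fun R) (fun i => tsubst th (r_lhs R i))
        (esubst th (r_rhs R)) (map (csubst th) (r_conds R)).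

Definition cinstances (P : crule -> Prop) (R : crule) : Prop :=
  exists2 R0, P R0 & exists th, R = crule_subst th R0.

(* crwl P Pi psi: the c-statement psi <= Pi is derivable from P.              *)
Inductive crwl (P : crule -> Prop) (Pi : seq (prim_constr C V)) :
    stmt S (basic C) F V -> Prop :=
| TI psi :
    stmt_wf psi -> trivial Pi psi -> crwl P Pi psi
| RR v :
    ~ trivial Pi (Prod (expr_of_term v : expr) v) -> is_var_or_basic v ->
    crwl P Pi (Prod (expr_of_term v) v)
| DC_ n (c : DC S n) es ts :
    ~ trivial Pi (Prod (ECon c es : expr) (TCon c ts)) ->
    (forall i, crwl P Pi (Prod (es i) (ts i))) ->
    crwl P Pi (Prod (ECon c es) (TCon c ts))
| DF_ (R : crule) (es : 'I_(r_ar R) -> expr) (t : term) :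
    ~ trivial Pi (Prod (EDef (r_fun R) es) t) ->
    cinstances P R ->
    (forall i, crwl P Pi (Prod (es i) (r_lhs R i))) ->
    crwl P Pi (Prod (r_rhs R) t) ->
    (forall delta, List.In delta (r_conds R) -> crwl P Pi (Con delta)) ->
    crwl P Pi (Prod (EDef (r_fun R) es) t)
| PF_ n (p : PF S n) es ts v :
    ~ trivial Pi (Prod (EPrim p es : expr) v) ->
    (forall i, crwl P Pi (Prod (es i) (ts i))) ->
    is_simple v -> entails_prod Pi p ts v ->
    crwl P Pi (Prod (EPrim p es) v)
| AC n (p : PF S n) es ts v :
    ~ trivial Pi (Con (Constr p es v : constr)) ->
    (forall i, crwl P Pi (Prod (es i) (ts i))) ->
    is_simple v -> entails Pi (prim_app p ts v) ->
    crwl P Pi (Con (Constr p es v)).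

Definition csol (P : crule -> Prop) (G : seq constr)
    (th : subst S (basic C) V) (Pi : seq (prim_constr C V)) : Prop :=
  all (fun c => atomic c) Pi /\
  forall delta, List.In delta G -> crwl P Pi (Con (csubst th delta)).

End CRWL.

Definition svar : eqType := nat.
Definition qvar : eqType := nat.
Definition tvar : eqType := (svar + qvar)%type.
Definition inV (x : svar) : tvar := inl x.
Definition inW (w : qvar) : tvar := inr w.

(* f' of arity n+1 for each f of arity n.                                     *)
Definition DFT (F : nat -> Type) (n : nat) : Type :=
  if n is n'.+1 then F n' else void.

Section Transformation.
Context (disp : Order.disp_t) (D : tbLatticeType disp) (circ : D -> D -> D).
Context (S : signature) (C : cdomain S) (X : expressible circ C).
Context (F : nat -> Type).
Local Notation sexpr := (expr S (basic C) F svar).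
Local Notation sconstr := (constr S (basic C) F svar).
Local Notation tterm := (term S (basic C) tvar).
Local Notation texpr := (expr S (basic C) (DFT F) tvar).
Local Notation tconstr := (constr S (basic C) (DFT F) tvar).
Local Notation qrule := (qrule D C F svar).
Local Notation crule := (crule C (DFT F) tvar).

Definition dvaluation (V : eqType) (mu : subst S (basic C) V) : Prop :=
  forall x, vdom mu x ->
    exists2 d : D, d != \bot & mu x = of_gterm (qterm X d).

(* (delta_i # W_i, W_i |> beta_i)_{i < m}                                      *)
Record goal := Goal {
  g_m : nat;
  g_con : 'I_g_m -> sconstr;
  g_var : 'I_g_m -> qvar;
  g_thr : 'I_g_m -> D }.
#[global] Arguments g_con _ _ : clear implicits.
#[global] Arguments g_var _ _ : clear implicits.
#[global] Arguments g_thr _ _ : clear implicits.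

Definition goal_wf (G : goal) : Prop :=
  [/\ forall i, atomic (g_con G i),
      injective (g_var G : 'I_(g_m G) -> qvar)
    & forall i, g_thr G i != \bot].

Definition meets_thresholds (G : goal) (mu : subst S (basic C) qvar) : Prop :=
  forall i, exists2 d, mu (g_var G i) = of_gterm (qterm X d) & g_thr G i <= d.

Definition qsol (P : qrule -> Prop) (G : goal)
    (sigma : subst S (basic C) svar) (mu : subst S (basic C) qvar)
    (Pi : seq (prim_constr C svar)) : Prop :=
  [/\ dvaluation mu, all (fun c => atomic c) Pi
    & forall i : 'I_(g_m G), exists d,
        [/\ d != \bot, mu (g_var G i) = of_gterm (qterm X d),
            g_thr G i <= d
          & qcrwl circ P Pi (Con (csubst sigma (g_con G i))) d]].

Definition wv (w : qvar) : tterm := TVar (inW w).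
Definition dv (d : D) : tterm := of_gterm (qterm X d).

Definition qVal (t : tterm) : seq tconstr :=
  [seq csubst (fun=> t) (constr_of_prim c) | c <- qval X].

Definition qBound (t1 t2 t3 : tterm) : seq tconstr :=
  [seq csubst (tnth [tuple t1; t2; t3]) (constr_of_prim c) | c <- qbound X].

(* t1 <| t2                                                                   *)
Definition qLe (t1 t2 : tterm) : seq tconstr := qBound t1 (dv \top) t2.

(* The family of all w <| a o w' for w' in ws, replaced by w <| a if ws is    *)
(* empty.  For a = \top, w <| a o w' is syntactically the constraint w <| w'. *)
Definition qFamily (w : qvar) (a : D) (ws : seq qvar) : seq tconstr :=
  if ws is [::] then qLe (wv w) (dv a)
  else flatten [seq qBound (wv w) (dv a) (wv w') | w' <- ws].

(* A transform (e', Omega, W) together with the qualification variables       *)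
(* introduced in it.                                                          *)
Record transf (T : Type) := Transf {
  tr_obj : T;
  tr_omega : seq tconstr;
  tr_qvars : seq qvar;
  tr_new : seq qvar }.

(* The choice of the new variables is left open: transforms are given by      *)
(* relations, and freshness is imposed on all the variables introduced in a   *)
(* rule or goal by the [uniq] conditions of [trRule] and [trGoal].            *)
Inductive trExpr : sexpr -> transf texpr -> Prop :=
| tr_bot : trExpr EBot (Transf EBot [::] [::] [::])
| tr_var x : trExpr (EVar x) (Transf (EVar (inV x)) [::] [::] [::])
| tr_bas u : trExpr (EBas u) (Transf (EBas u) [::] [::] [::])
| tr_con n (c : DC S n) es (rs : 'I_n -> transf texpr) :
    (forall i, trExpr (es i) (rs i)) ->
    trExpr (ECon c es)
      (Transf (ECon c (fun i => tr_obj (rs i)))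
              (bigcat (fun i => tr_omega (rs i)))
              (bigcat (fun i => tr_qvars (rs i)))
              (bigcat (fun i => tr_new (rs i))))
| tr_prim n (p : PF S n) es (rs : 'I_n -> transf texpr) :
    (forall i, trExpr (es i) (rs i)) ->
    trExpr (EPrim p es)
      (Transf (EPrim p (fun i => tr_obj (rs i)))
              (bigcat (fun i => tr_omega (rs i)))
              (bigcat (fun i => tr_qvars (rs i)))
              (bigcat (fun i => tr_new (rs i))))
| tr_def n (f : F n) es (rs : 'I_n -> transf texpr) (w : qvar) :
    (forall i, trExpr (es i) (rs i)) ->
    trExpr (EDef f es)
      (Transf (EDef (f : DFT F n.+1)
                    (snoc (fun i => tr_obj (rs i)) (EVar (inW w))))
              (bigcat (fun i => tr_omega (rs i)) ++ qVal (wv w) ++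
               flatten [seq qLe (wv w) (wv w')
                       | w' <- bigcat (fun i => tr_qvars (rs i))])
              [:: w]
              (w :: bigcat (fun i => tr_new (rs i)))).

Inductive trConstr : sconstr -> transf tconstr -> Prop :=
| tr_constr n (p : PF S n) es v (rs : 'I_n -> transf texpr) :
    (forall i, trExpr (es i) (rs i)) ->
    trConstr (Constr p es v)
      (Transf (Constr p (fun i => tr_obj (rs i)) (trename inV v))
              (bigcat (fun i => tr_omega (rs i)))
              (bigcat (fun i => tr_qvars (rs i)))
              (bigcat (fun i => tr_new (rs i)))).

Inductive trRule : qrule -> crule -> Prop :=
| tr_rule n (f : F n) ts a r m (deltas : 'I_m -> sconstr)
      (w : qvar) (tr : transf texpr) (tds : 'I_m -> transf tconstr) :
    trExpr r tr ->
    (forall j, trConstr (deltas j) (tds j)) ->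
    uniq (w :: tr_new tr ++ bigcat (fun j => tr_new (tds j))) ->
    trRule (QRule f ts a r deltas)
      (CRule (f : DFT F n.+1)
             (snoc (fun i => trename inV (ts i)) (wv w))
             (tr_obj tr)
             (qVal (wv w) ++ tr_omega tr ++ qFamily w a (tr_qvars tr) ++
              bigcat (fun j => tr_omega (tds j) ++
                               qFamily w a (tr_qvars (tds j)) ++
                               [:: tr_obj (tds j)]))).

Definition trProgram (P : qrule -> Prop) (P' : crule -> Prop) : Prop :=
  (forall R, P R -> exists2 R', P' R' & trRule R R') /\
  (forall R', P' R' -> exists2 R, P R & trRule R R').

(* trGoal G G' ws: G' is a transform of G that introduces the variables ws.   *)
Inductive trGoal (G : goal) : seq tconstr -> seq qvar -> Prop :=
| tr_goal (tds : 'I_(g_m G) -> transf tconstr) :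
    (forall i, trConstr (g_con G i) (tds i)) ->
    uniq (bigcat (fun i => [:: g_var G i]) ++
          bigcat (fun i => tr_new (tds i))) ->
    trGoal G
      (bigcat (fun i => tr_omega (tds i) ++ qVal (wv (g_var G i)) ++
                        qFamily (g_var G i) \top (tr_qvars (tds i)) ++
                        qLe (dv (g_thr G i)) (wv (g_var G i)) ++
                        [:: tr_obj (tds i)]))
      (bigcat (fun i => tr_new (tds i))).

End Transformation.

(* Main.v *)
(* A source derivation determines the qualification values by itself, so the
   transformation only makes them explicit.  From left to right, by induction on
   the qualified derivation, every new qualification variable is given the value
   at which the call it decorates was derived; values chosen for different
   subderivations are compatible because the new variables are distinct.  From
   right to left, by induction on the target derivation, the qualification of an
   expression is any common lower bound of its top-level qualification
   variables: in a rule application it is their meet, over which the attenuation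
   distributes.
   The link is that a primitive constraint over ground values is derivable
   exactly if it is true.  Qualification arguments in a target derivation may
   however be non-ground, with Pi implying that they are qualifications; they
   are read under one fixed solution of Pi. *)
Require Import Defs.
From Stdlib Require List.
From Stdlib Require Import Classical FunctionalExtensionality.
From mathcomp Require Import all_boot all_order.

Set Implicit Arguments.
Unset Strict Implicit.
Unset Printing Implicit Defensive.

Import Order.TTheory.
Local Open Scope order_scope.

(** * Finite concatenations, disjoint families and extended tuples *)

Section Lists.

Lemma mem_bigcat (T : eqType) n (s : 'I_n -> seq T) x :
  reflect (exists i, x \in s i) (x \in bigcat s).
Proof.
apply: (iffP flatten_mapP) => [[i _ xi]|[i xi]]; first by exists i.
by exists i; rewrite ?mem_enum.
Qed.

Lemma sub_bigcat (T : eqType) n (s s' : 'I_n -> seq T) :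
  (forall i, {subset s i <= s' i}) -> {subset bigcat s <= bigcat s'}.
Proof.
by move=> sub x /mem_bigcat[i xi]; apply/mem_bigcat; exists i; apply: sub.
Qed.

Lemma eq_bigcat T n (s s' : 'I_n -> seq T) : s =1 s' -> bigcat s = bigcat s'.
Proof. by move=> e; rewrite /bigcat (eq_map e). Qed.

Lemma bigcat_nil T n : bigcat (fun _ : 'I_n => [::] : seq T) = [::].
Proof. by rewrite /bigcat; elim: (enum _). Qed.

Lemma map_bigcat T T' (f : T -> T') n (s : 'I_n -> seq T) :
  map f (bigcat s) = bigcat (fun i => map f (s i)).
Proof. by rewrite /bigcat map_flatten -map_comp. Qed.

Lemma uniq_bigcat (T : eqType) n (s : 'I_n -> seq T) :
  uniq (bigcat s) ->
  (forall i, uniq (s i)) /\ (forall i j x, x \in s i -> x \in s j -> i = j).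
Proof.
rewrite /bigcat => U.
(* The enumeration of ['I_n] is generalised to any duplicate-free list of indices, on which
   induction is possible. *)
have aux : forall r : seq 'I_n, uniq (flatten (map s r)) -> uniq r ->
  (forall i, i \in r -> uniq (s i)) /\
  (forall i j x, i \in r -> j \in r -> x \in s i -> x \in s j -> i = j).
  elim=> [//|k r IH] /=; rewrite cat_uniq => /and3P[uk /hasPn dk ur].
  move=> /andP[nk r1]; have [IH1 IH2] := IH ur r1.
  have D i x : i \in r -> x \in s i -> x \notin s k.
    by move=> ir xi; apply: dk; apply/flatten_mapP; exists i.
  split=> [i|i j x]; rewrite !inE; first by case/predU1P=> [->//|/IH1].
  case/predU1P=> [->|ir] /predU1P[->|jr] //; last by apply: IH2.
    by move=> xk /(D _ _ jr)/negP.
  by move=> /(D _ _ ir)/negP.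
have [H1 H2] := aux _ U (enum_uniq _); split=> [i|i j x].
  by apply: H1; rewrite mem_enum.
by apply: H2; rewrite mem_enum.
Qed.

(** Each element lies in at most one of the lists, so the index found by [pick] is forced. This
    glues values chosen separately for disjoint sets of fresh variables. *)
Lemma join_functions (T : eqType) A n (s : 'I_n -> seq T)
    (r : 'I_n -> T -> A) (r0 : T -> A) :
  uniq (bigcat s) ->
  exists f, (forall i x, x \in s i -> f x = r i x) /\
            (forall x, x \notin bigcat s -> f x = r0 x).
Proof.
move=> /uniq_bigcat[_ U].
exists (fun x => if [pick i | x \in s i] is Some i then r i x else r0 x).
split=> [i x xi|x nx]; case: pickP => [j xj|n0] //.
- by rewrite (U _ _ _ xi xj).
- by rewrite n0 in xi.
- by case/negP: nx; apply/mem_bigcat; exists j.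
Qed.

Lemma In_map A B (f : A -> B) l y :
  List.In y (map f l) <-> exists2 x, List.In x l & y = f x.
Proof.
elim: l => [|a l IH] /=; first by split=> // -[].
rewrite IH; split.
  by case=> [<-|[x xl ->]]; [exists a; [left|]|exists x; [right|]].
by case=> x [->|xl] ->; [left|right; exists x].
Qed.

Lemma In_cat A (l1 l2 : seq A) x :
  List.In x (l1 ++ l2) <-> List.In x l1 \/ List.In x l2.
Proof. exact: List.in_app_iff. Qed.

Lemma In_flatten_map (T : eqType) A (f : T -> seq A) l x :
  List.In x (flatten (map f l)) <-> exists2 y, y \in l & List.In x (f y).
Proof.
elim: l => [|a l IH] /=; first by split=> // -[].
rewrite In_cat IH; split.
  case=> [xa|[y yl xy]]; first by exists a; rewrite ?mem_head.
  by exists y; rewrite ?inE ?yl ?orbT.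
case=> y; rewrite inE => /predU1P[->|yl] xy; first by left.
by right; exists y.
Qed.

Lemma In_bigcat A n (s : 'I_n -> seq A) x :
  List.In x (bigcat s) <-> exists i, List.In x (s i).
Proof.
rewrite In_flatten_map; split=> [[i _ xi]|[i xi]]; first by exists i.
by exists i; rewrite ?mem_enum.
Qed.

Lemma snoc_max T n (a : 'I_n -> T) x : snoc a x ord_max = x.
Proof. by rewrite /snoc unlift_none. Qed.

Lemma snoc_lift T n (a : 'I_n -> T) x i : snoc a x (lift ord_max i) = a i.
Proof. by rewrite /snoc liftK. Qed.

Lemma snoc_comp T T' (f : T -> T') n (a : 'I_n -> T) x :
  (fun i => f (snoc a x i)) = snoc (fun i => f (a i)) (f x).
Proof. by apply: functional_extensionality => i; rewrite /snoc; case: unlift. Qed.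

End Lists.

(** * Composition and locality of substitutions *)

Section Substitution.
Context (S : signature) (B : Type).

Lemma tsubst_comp V1 V2 V3 (s1 : V1 -> term S B V2) (s2 : V2 -> term S B V3) t :
  tsubst s2 (tsubst s1 t) = tsubst (fun x => tsubst s2 (s1 x)) t.
Proof.
elim: t => //= n c ts IH; congr TCon.
exact: functional_extensionality.
Qed.

Lemma tsubst_id V (t : term S B V) : tsubst TVar t = t.
Proof.
elim: t => //= n c ts IH; congr TCon.
exact: functional_extensionality.
Qed.

Lemma esubst_term F V1 V2 (s : V1 -> term S B V2) t :
  esubst s (expr_of_term t : expr S B F V1) = expr_of_term (tsubst s t).
Proof.
elim: t => //= n c ts IH; congr ECon.
exact: functional_extensionality.
Qed.

Lemma esubst_comp F V1 V2 V3 (s1 : V1 -> term S B V2) (s2 : V2 -> term S B V3)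
    (e : expr S B F V1) :
  esubst s2 (esubst s1 e) = esubst (fun x => tsubst s2 (s1 x)) e.
Proof.
elim: e => //= [x|n c es IH|n p es IH|n f es IH]; first exact: esubst_term.
all: by apply: f_equal; apply: functional_extensionality.
Qed.

Lemma csubst_comp F V1 V2 V3 (s1 : V1 -> term S B V2) (s2 : V2 -> term S B V3)
    (c : constr S B F V1) :
  csubst s2 (csubst s1 c) = csubst (fun x => tsubst s2 (s1 x)) c.
Proof.
rewrite /csubst /= tsubst_comp; congr Constr.
by apply: functional_extensionality => i; rewrite esubst_comp.
Qed.

Lemma expr_of_prim_term F V (t : term S B V) :
  expr_of_prim F (expr_of_term t) = expr_of_term t.
Proof.
elim: t => //= n c ts IH; congr ECon.
exact: functional_extensionality.
Qed.

Lemma esubst_prim F V1 V2 (s : V1 -> term S B V2) (e : expr S B noDF V1) :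
  esubst s (expr_of_prim F e) = expr_of_prim F (esubst s e).
Proof.
elim: e => //= [x|n c es IH|n p es IH]; first by rewrite expr_of_prim_term.
all: by apply: f_equal; apply: functional_extensionality.
Qed.

Lemma csubst_prim F V1 V2 (s : V1 -> term S B V2) (c : constr S B noDF V1) :
  csubst s (constr_of_prim c : constr S B F V1) = constr_of_prim (csubst s c).
Proof.
rewrite /csubst /constr_of_prim /=; congr Constr.
by apply: functional_extensionality => i; rewrite esubst_prim.
Qed.

Lemma eq_tsubst_in (V : eqType) V' (s s' : V -> term S B V') t :
  {in tvars t, s =1 s'} -> tsubst s t = tsubst s' t.
Proof.
elim: t => //= [x|n c ts IH] e; first by rewrite e ?mem_head.
congr TCon; apply: functional_extensionality => i; apply: IH => x xi.
by apply: e; apply/mem_bigcat; exists i.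
Qed.

Lemma eq_esubst_in F (V : eqType) V' (s s' : V -> term S B V')
    (e : expr S B F V) :
  {in evars e, s =1 s'} -> esubst s e = esubst s' e.
Proof.
elim: e => //= [x|n c es IH|n p es IH|n f es IH] e.
  by rewrite e ?mem_head.
all: apply: f_equal; apply: functional_extensionality => i; apply: IH => x xi.
all: by apply: e; apply/mem_bigcat; exists i.
Qed.

Lemma eq_csubst_in F (V : eqType) V' (s s' : V -> term S B V')
    (c : constr S B F V) :
  {in cvars c, s =1 s'} -> csubst s c = csubst s' c.
Proof.
move=> e; rewrite /csubst; congr Constr.
  apply: functional_extensionality => i; apply: eq_esubst_in => x xi.
  by apply: e; rewrite mem_cat; apply/orP; left; apply/mem_bigcat; exists i.
by apply: eq_tsubst_in => x xv; apply: e; rewrite mem_cat xv orbT.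
Qed.

Lemma tsubst_of_gterm V V' (s : V -> term S B V') g :
  tsubst s (of_gterm g) = of_gterm g.
Proof.
by rewrite /of_gterm tsubst_comp; congr tsubst; apply: functional_extensionality.
Qed.

Lemma tsubst_of_gtermK V (s : V -> gterm S B) g : tsubst s (of_gterm g) = g.
Proof.
rewrite /of_gterm tsubst_comp -[RHS]tsubst_id; congr tsubst.
exact: functional_extensionality.
Qed.

(** The embedding of ground constraints has a left inverse, so the ground constraint hidden in
    [solves] can be recovered. *)
Lemma csubst_voidK F V (s : V -> gterm S B) (c : constr S B F void) :
  csubst s (csubst (@of_void_term S B V) c) = c.
Proof.
rewrite csubst_comp /csubst; case: c => n p es v /=; congr Constr.
  apply: functional_extensionality => i.
  elim: (es i) => //= [m c fs IH|m q fs IH|m f fs IH];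
    by apply: f_equal; apply: functional_extensionality.
by rewrite -[RHS]tsubst_id; congr tsubst; apply: functional_extensionality.
Qed.

Lemma is_simple_trename V V' (f : V -> V') (t : term S B V) :
  is_simple (trename f t) = is_simple t.
Proof. by case: t. Qed.

Lemma trename_subst_sum V1 V2 (s1 : subst S B V1) (s2 : subst S B V2) t :
  tsubst (subst_sum s1 s2) (trename inl t) = trename inl (tsubst s1 t).
Proof. by rewrite /trename !tsubst_comp. Qed.

End Substitution.

(** * The information ordering *)

Section InformationOrder.
Context (S : signature) (B V : Type).

(** Since transitivity is a constructor of [tle], inversion needs an induction that composes the two
    shapes obtained for a transitive step. *)
Lemma tle_inv (t u : term S B V) :
  tle t u -> t = TBot \/
    match u with
    | TCon n c us => exists2 ts, t = TCon c ts & forall i, tle (ts i) (us i)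
    | _ => t = u
    end.
Proof.
elim=> {t u} [t|t|t1 t2 t3 _ IH1 _ IH2|n c ts ts' le _].
- by left.
- right; case: t => // n c ts; exists ts => // i; exact: tle_refl.
- case: IH2 => [e2|]; first by left; rewrite e2 in IH1; case: IH1.
  case: t3 => [|x|u|n c us] e2; try by rewrite e2 in IH1.
  case: e2 => ts2 e2 le2; rewrite {}e2 in IH1.
  case: IH1 => [->|[ts -> le1]]; [by left|right; exists ts => // i].
  exact: tle_trans (le1 i) (le2 i).
- by right; exists ts.
Qed.

(** A smaller term differs from a larger one only by occurrences of bot, and a total term has
    none. *)
Lemma tle_total (t u : term S B V) : tle t u -> ttotal t -> t = u.
Proof.
elim: u t => [|x|u|n c us IH] t /tle_inv[->//|] //=.
case=> ts -> le /= tot; congr TCon.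
by apply: functional_extensionality => i; apply: IH.
Qed.

Lemma tsubst_tle V' (s s' : V' -> term S B V) t :
  (forall x, tle (s x) (s' x)) -> tle (tsubst s t) (tsubst s' t).
Proof.
move=> le; elim: t => //= [|u|n c ts IH]; try exact: tle_refl.
exact: tle_con.
Qed.

End InformationOrder.

(** * Evaluation, truth and entailment under ground assignments *)

Section GroundSemantics.
Context (S : signature) (C : cdomain S).
Local Notation gterm := (gterm S (basic C)).
Local Notation term := (term S (basic C)).
Local Notation pconstr := (constr S (basic C) noDF).

Lemma eval_inv (e : expr S (basic C) noDF void) (t : gterm) :
  eval e t -> t = TBot \/
    match e with
    | EBas u => t = TBas u
    | ECon n c es => exists2 ts, t = TCon c ts & forall i, eval (es i) (ts i)
    | EPrim n p es => exists2 ts, interp p ts t & forall i, eval (es i) (ts i)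
    | _ => False
    end.
Proof.
case=> [|||] *; try by [left|right]; right.
  by eexists.
by eexists; eauto.
Qed.

(** All that evaluation can do to a ground term is to cut subterms down to bot. *)
Lemma eval_term (u t : gterm) :
  eval (expr_of_term u) t <-> tle t u.
Proof.
split.
  elim: u t => [|[]|b|n c us IH] t /eval_inv[->|] //=; try exact: tle_bot.
    by move=> ->; apply: tle_refl.
  by case=> ts -> le; apply: tle_con => i; apply: IH.
elim: u t => [|[]|b|n c us IH] t /tle_inv[->|] //=; try exact: eval_bot.
- by move=> ->; exact: eval_bot.
- by move=> ->; exact: eval_bas.
by case=> ts -> le; apply: eval_con => i; apply: IH.
Qed.

(** An evaluation may first approximate the arguments; monotonicity of [interp] carries its result
    back to the exact ones. *)
Lemma ctrue_app n (p : PF S n) (ts : 'I_n -> gterm) (v : gterm) :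
  ctrue (Constr p (fun i => expr_of_term (ts i)) v) <-> ttotal v /\ interp p ts v.
Proof.
split=> -[/= tot H]; split=> //.
  case/eval_inv: H tot => [-> //|[us pus le] _].
  by apply: interp_monotone pus _ (tle_refl _) => i; apply/eval_term.
by apply: eval_prim H => i; apply/eval_term; apply: tle_refl.
Qed.

Lemma eval_subst_tle V (a b : V -> gterm) (e : expr S (basic C) noDF V) t :
  (forall x, tle (a x) (b x)) -> eval (esubst a e) t -> eval (esubst b e) t.
Proof.
move=> le; elim: e t => [|x|u|n c es IH|n p es IH|n []] t //=.
- by move=> /eval_term lt; apply/eval_term; apply: tle_trans (le x).
- case/eval_inv=> [->|[ts -> H]]; first exact: eval_bot.
  by apply: eval_con => i; apply: IH.
- case/eval_inv=> [->|[ts pt H]]; first exact: eval_bot.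
  by apply: eval_prim pt => i; apply: IH.
Qed.

(** Evaluation is monotone in the assignment, and the right-hand side, being total under [a], cannot
    change when [a] grows to [b]. *)
Lemma ctrue_subst_tle V (a b : V -> gterm) (c : pconstr V) :
  (forall x, tle (a x) (b x)) -> ctrue (csubst a c) -> ctrue (csubst b c).
Proof.
move=> le [/= tot ev]; rewrite /ctrue /=.
have <- := tle_total (tsubst_tle (c_rhs c) le) tot; split=> //.
have := @eval_subst_tle _ a b (EPrim (c_pf c) (c_args c)) _ le.
exact.
Qed.

Lemma ctrue_simple (c : pconstr void) : ctrue c -> is_simple (c_rhs c).
Proof.
case=> tot /eval_inv[e|[ts /interp_radical[e|//] _]];
  by rewrite e in tot.
Qed.

(** A replacement for [Sol], whose valuations are partial and take values among terms over [V].
    Total ground assignments compose directly with substitutions, and the lemmas below show that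
    they decide satisfiability and entailment. *)
Definition gsol V (Pi : seq (pconstr V)) (g : V -> gterm) : Prop :=
  forall c, List.In c Pi -> ctrue (csubst g c).

Context (V : eqType).
Implicit Types (Pi : seq (pconstr V)) (g : V -> gterm).

Let oog g : subst S (basic C) V := fun x => of_gterm (g x).
(** The default bot for remaining variables is harmless: a constraint solved by [eta] has no
    variable left after applying [eta]. *)
Let ground (eta : subst S (basic C) V) : V -> gterm :=
  fun x => tsubst (fun=> TBot) (eta x).

Lemma vdom_of_gterm g : vdom (oog g) =i predT.
Proof. by move=> x; rewrite unfold_in /oog; case: (g x) => // -[]. Qed.

Lemma solves_of_gterm g (c : pconstr V) :
  solves (oog g) c <-> ctrue (csubst g c).
Proof.
have E : csubst (oog g) c = csubst (@of_void_term S (basic C) V) (csubst g c).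
  by rewrite csubst_comp.
split=> [[c0 e0 t0]|t]; last by exists (csubst g c).
have := congr1 (csubst (fun=> TBot : gterm)) E.
by rewrite e0 !csubst_voidK => <-.
Qed.

Lemma Sol_of_gterm Pi g : Sol Pi (oog g) <-> gsol Pi g.
Proof.
split=> [[_ H] c /H/solves_of_gterm //|H]; split=> [x _|c /H/solves_of_gterm //].
by exists (g x).
Qed.

Lemma solves_ground eta (c : pconstr V) :
  solves eta c -> ctrue (csubst (ground eta) c).
Proof.
case=> c0 e0 t0; have := congr1 (csubst (fun=> TBot : gterm)) e0.
by rewrite csubst_voidK csubst_comp => ->.
Qed.

Lemma Unsat_gsol Pi : Unsat Pi <-> ~ exists g, gsol Pi g.
Proof.
split=> [U [g /Sol_of_gterm /U]//|N eta [_ H]].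
by apply: N; exists (ground eta) => c /H /solves_ground.
Qed.

Lemma groundK eta (c : pconstr V) :
  valuation eta -> {subset cvars c <= vdom eta} ->
  forall x, x \in cvars c -> eta x = oog (ground eta) x.
Proof.
move=> val dom x /dom /val [h e].
by rewrite /oog /ground e tsubst_of_gtermK.
Qed.

(** A ground assignment is defined everywhere, and conversely a valuation defined on the variables
    of [c] agrees there with its grounding. *)
Lemma entails_gsol Pi (c : pconstr V) :
  entails Pi c <-> forall g, gsol Pi g -> ctrue (csubst g c).
Proof.
split=> [E g sg|H eta dom [val sol]].
  apply/solves_of_gterm; apply: E; last exact/Sol_of_gterm.
  by move=> c0 _ x _; rewrite vdom_of_gterm.
have /H t : gsol Pi (ground eta) by move=> c0 /sol /solves_ground.
exists (csubst (ground eta) c) => //; rewrite csubst_comp.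
by apply/eq_csubst_in/groundK => //; apply: dom; left.
Qed.

Lemma entails_prod_gsol Pi n (p : PF S n) ts v :
  entails_prod Pi p ts v <->
  forall g, gsol Pi g -> interp p (fun i => tsubst g (ts i)) (tsubst g v).
Proof.
split=> [E g sg|H eta dom [val sol]].
  have [| |gs [h [e1 e2]]] := E (oog g).
  - by move=> c0 _ x _; rewrite vdom_of_gterm.
  - exact/Sol_of_gterm.
  have D t (k : gterm) : tsubst (oog g) t = of_gterm k -> tsubst g t = k.
    move=> e; rewrite -(tsubst_of_gtermK ((fun=> TBot) : V -> gterm) k) -e tsubst_comp.
    by congr tsubst; apply: functional_extensionality => x;
      rewrite /oog tsubst_of_gtermK.
  rewrite (D _ _ e2); suff -> : (fun i => tsubst g (ts i)) = gs by [].
  by apply: functional_extensionality => i; apply: D.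
have sg : gsol Pi (ground eta) by move=> c0 /sol /solves_ground.
have K : forall x, x \in cvars (prim_app p ts v) -> eta x = oog (ground eta) x.
  by apply: groundK => //; apply: dom; left.
have tvarsE (t : term V) : evars (expr_of_term t : expr S (basic C) noDF V) = tvars t.
  elim: t => //= m c us IH; exact: eq_bigcat.
exists (fun i => tsubst (ground eta) (ts i)), (tsubst (ground eta) v).
split; last exact: H.
  move=> i; rewrite /of_gterm tsubst_comp; apply: eq_tsubst_in => x xi.
  apply: K; rewrite mem_cat; apply/orP; left; apply/mem_bigcat; exists i.
  by rewrite tvarsE.
rewrite /of_gterm tsubst_comp; apply: eq_tsubst_in => x xv.
by apply: K; rewrite mem_cat xv orbT.
Qed.

End GroundSemantics.

(** * Target derivability, and its agreement with truth on primitive constraints *)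

Section Derivability.
Context (S : signature) (C : cdomain S) (F : nat -> Type) (V : eqType).
Local Notation term := (term S (basic C) V).
Local Notation expr := (expr S (basic C) F V).
Local Notation constr := (constr S (basic C) F V).
Local Notation pconstr := (Defs.constr S (basic C) noDF).
Context (P : crule C F V -> Prop) (Pi : seq (pconstr V)).

(* The rules of CRWL without their nontriviality conditions, which are         *)
(* redundant because trivial statements are derivable anyway.                  *)
Lemma crwl_bot (e : expr) : crwl P Pi (Prod e TBot).
Proof. by apply: TI => //; right; exists e. Qed.

Lemma crwl_refl (v : term) :
  is_var_or_basic v -> crwl P Pi (Prod (expr_of_term v) v).
Proof.
move=> hv; have [t|t] := classic (trivial Pi (Prod (expr_of_term v : expr) v)).
  exact: TI.
exact: RR.
Qed.

Lemma crwl_con n (c : DC S n) (es : 'I_n -> expr) ts :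
  (forall i, crwl P Pi (Prod (es i) (ts i))) ->
  crwl P Pi (Prod (ECon c es) (TCon c ts)).
Proof.
move=> H; have [t|t] := classic (trivial Pi (Prod (ECon c es) (TCon c ts))).
  exact: TI.
exact: DC_.
Qed.

Lemma crwl_def R (es : 'I_(r_ar R) -> expr) t :
  cinstances P R ->
  (forall i, crwl P Pi (Prod (es i) (r_lhs R i))) ->
  crwl P Pi (Prod (r_rhs R) t) ->
  (forall delta, List.In delta (r_conds R) -> crwl P Pi (Con delta)) ->
  crwl P Pi (Prod (EDef (r_fun R) es) t).
Proof.
move=> *; have [tr|tr] := classic (trivial Pi (Prod (EDef (r_fun R) es) t)).
  exact: TI.
exact: DF_.
Qed.

Lemma crwl_prim n (p : PF S n) (es : 'I_n -> expr) ts v :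
  (forall i, crwl P Pi (Prod (es i) (ts i))) ->
  is_simple v -> entails_prod Pi p ts v ->
  crwl P Pi (Prod (EPrim p es) v).
Proof.
move=> *; have [tr|tr] := classic (trivial Pi (Prod (EPrim p es) v)).
  exact: TI.
exact: PF_.
Qed.

Lemma crwl_constr n (p : PF S n) (es : 'I_n -> expr) ts v :
  (forall i, crwl P Pi (Prod (es i) (ts i))) ->
  is_simple v -> entails Pi (prim_app p ts v) ->
  crwl P Pi (Con (Constr p es v)).
Proof.
move=> *; have [tr|tr] := classic (trivial Pi (Con (Constr p es v))).
  exact: TI.
exact: Defs.AC.
Qed.

(** Meant for expressions without defined symbols, hence the empty information in the [EDef] case;
    calls are treated by induction on derivations instead. *)
Lemma crwl_inv (psi : stmt S (basic C) F V) : crwl P Pi psi ->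
  match psi with
  | Prod e t =>
    [\/ Unsat Pi, t = TBot |
      match e with
      | EBot => False
      | EVar x => t = TVar x
      | EBas u => t = TBas u
      | ECon n c es =>
          exists2 ts, t = TCon c ts & forall i, crwl P Pi (Prod (es i) (ts i))
      | EPrim n p es =>
          exists2 ts, entails_prod Pi p ts t &
                      forall i, crwl P Pi (Prod (es i) (ts i))
      | EDef n f es => True
      end]
  | Con c =>
    atomic c /\
    (Unsat Pi \/
     exists2 ts, entails Pi (prim_app (c_pf c) ts (c_rhs c)) &
                 forall i, crwl P Pi (Prod (c_args c i) (ts i)))
  end.
Proof.
case=> {psi} [[e t|c]|v _|n c es ts _|R es t _|n p es ts v _|n p es ts v _].
- by move=> _ [U|[e0 [_ ->]]]; [apply: Or31|apply: Or32].
- by move=> at_c [U|[e0 //]]; split=> //; left.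
- by case: v => //= *; apply: Or33.
- by move=> H; apply: Or33; exists ts.
- by move=> *; apply: Or33.
- by move=> H _ E; apply: Or33; exists ts.
- by move=> H sv E; split=> //; right; exists ts.
Qed.

(** Without defined symbols no program rule applies, so the derivation replays as an evaluation once
    a solution of [Pi] turns entailments into values of primitives. *)
Lemma crwl_prim_sound (e : Defs.expr S (basic C) noDF V) t g :
  gsol Pi g -> crwl P Pi (Prod (expr_of_prim F e) t) ->
  eval (esubst g e) (tsubst g t).
Proof.
move=> sg; have sat : ~ Unsat Pi by move=> /Unsat_gsol; apply; exists g.
elim: e t => [|x|u|n c es IH|n p es IH|n []] t;
  move=> /crwl_inv /= [/sat//|->|] //; try exact: eval_bot.
- by move=> ->; apply/eval_term; apply: tle_refl.
- by move=> ->; exact: eval_bas.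
- by case=> ts -> H; apply: eval_con => i; apply: IH.
- case=> ts /entails_prod_gsol /(_ g sg) I H.
  by apply: eval_prim I => i; apply: IH.
Qed.

Lemma crwl_constr_sound (c : pconstr V) g :
  gsol Pi g -> crwl P Pi (Con (constr_of_prim c)) -> ctrue (csubst g c).
Proof.
move=> sg /crwl_inv[_ [/Unsat_gsol[]|]]; first by exists g.
case=> ts /entails_gsol /(_ g sg) T H.
have [/=|tot I] := (ctrue_app (c_pf c) (fun i => tsubst g (ts i)) (tsubst g (c_rhs c))).1.
  move: T; rewrite /csubst /=.
  congr (ctrue (Constr _ _ _)).
  by apply: functional_extensionality => i; rewrite esubst_term.
split=> //; apply: eval_prim I => i /=; exact: (crwl_prim_sound sg (H i)).
Qed.

Lemma crwl_term_sound (u t : term) g :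
  gsol Pi g -> crwl P Pi (Prod (expr_of_term u) t) ->
  tle (tsubst g t) (tsubst g u).
Proof.
rewrite -(expr_of_prim_term F u) => sg /(crwl_prim_sound sg).
by rewrite esubst_term => /eval_term.
Qed.

Lemma crwl_term_refl (t : term) : crwl P Pi (Prod (expr_of_term t) t).
Proof.
elim: t => [|x|u|n c ts IH] /=; first exact: crwl_bot.
- exact: (crwl_refl (v := TVar x)).
- exact: (crwl_refl (v := TBas u)).
- exact: crwl_con.
Qed.

(** Every evaluation rule has its counterpart in the logic. Radicality makes the value of a
    primitive either bot or simple, as [PF_] demands, and the entailment holds under every
    assignment because all terms are ground. *)
Lemma crwl_prim_complete (e : Defs.expr S (basic C) noDF void) t :
  eval e t ->
  crwl P Pi (Prod (expr_of_prim F (esubst (@of_void_term S (basic C) V) e))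
                  (of_gterm t)).
Proof.
elim=> {e t} [e|u|n c es ts _ IH|n p es ts t _ IH I].
- exact: crwl_bot.
- exact: (crwl_refl (v := TBas u)).
- exact: crwl_con.
have [->|st] := interp_radical I; first exact: crwl_bot.
apply: (crwl_prim IH); first by case: (t) st.
apply/entails_prod_gsol => g _; rewrite tsubst_of_gtermK.
suff -> : (fun i => tsubst g (of_gterm (ts i))) = ts by [].
by apply: functional_extensionality => i; rewrite tsubst_of_gtermK.
Qed.

Lemma crwl_constr_complete (c : pconstr void) :
  ctrue c ->
  crwl P Pi (Con (constr_of_prim (csubst (@of_void_term S (basic C) V) c))).
Proof.
move=> tc; have sc := ctrue_simple tc.
case: c tc sc => n p es v [/= tot /eval_inv[e|[ts I H]] sc].
  by rewrite e in tot.
apply: (crwl_constr (ts := fun i => of_gterm (ts i))).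
- by move=> i; apply: crwl_prim_complete.
- by case: (v) sc.
- apply/entails_gsol => g _; rewrite /csubst /= tsubst_of_gtermK.
  suff -> : (fun i => esubst g (expr_of_term (of_gterm (ts i)))) =
            (fun i => expr_of_term (ts i)) :> ('I_n -> Defs.expr _ _ noDF _).
    exact/ctrue_app.
  apply: functional_extensionality => i.
  by rewrite esubst_term tsubst_of_gtermK.
Qed.

Definition derivable_all (l : seq constr) : Prop :=
  forall c, List.In c l -> crwl P Pi (Con c).

Lemma derivable_all_cat l1 l2 :
  derivable_all (l1 ++ l2) <-> derivable_all l1 /\ derivable_all l2.
Proof.
split=> [H|[H1 H2] c /In_cat[/H1|/H2] //].
by split=> c lc; apply: H; apply/In_cat; [left|right].
Qed.

Lemma derivable_all_bigcat n (s : 'I_n -> seq constr) :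
  derivable_all (bigcat s) <-> forall i, derivable_all (s i).
Proof.
split=> [H i c lc|H c /In_bigcat[i /H] //].
by apply: H; apply/In_bigcat; exists i.
Qed.

Lemma derivable_all_flatten (T : eqType) (f : T -> seq constr) l :
  derivable_all (flatten (map f l)) <-> {in l, forall x, derivable_all (f x)}.
Proof.
split=> [H x xl c lc|H c /In_flatten_map[x xl /(H _ xl)] //].
by apply: H; apply/In_flatten_map; exists x.
Qed.

Lemma derivable_all1 c : derivable_all [:: c] <-> crwl P Pi (Con c).
Proof. by split=> [H|H _ [<-|[]]] //; apply: H; left. Qed.

End Derivability.

(** * Source rules without nontriviality conditions *)

Section QDerivability.
Context (disp : Order.disp_t) (D : tbLatticeType disp) (circ : D -> D -> D).
Context (S : signature) (C : cdomain S) (F : nat -> Type) (V : eqType).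
Local Notation term := (term S (basic C) V).
Local Notation expr := (expr S (basic C) F V).
Context (P : qrule D C F V -> Prop).
Context (Pi : seq (Defs.constr S (basic C) noDF V)).

Lemma qcrwl_bot (e : expr) d : d != \bot -> qcrwl circ P Pi (Prod e TBot) d.
Proof. by move=> nd; apply: QTI => //; right; exists e. Qed.

Lemma qcrwl_refl (v : term) d :
  d != \bot -> is_var_or_basic v ->
  qcrwl circ P Pi (Prod (expr_of_term v) v) d.
Proof.
move=> nd hv.
have [t|t] := classic (trivial Pi (Prod (expr_of_term v : expr) v)).
  exact: QTI.
exact: QRR.
Qed.

Lemma qcrwl_con n (c : DC S n) (es : 'I_n -> expr) ts d :
  d != \bot ->
  (forall i, qcrwl circ P Pi (Prod (es i) (ts i)) d) ->
  qcrwl circ P Pi (Prod (ECon c es) (TCon c ts)) d.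
Proof.
move=> nd H; have [t|t] := classic (trivial Pi (Prod (ECon c es) (TCon c ts))).
  exact: QTI.
by apply: (QDC (ds := fun=> d)).
Qed.

Lemma qcrwl_def R (es : 'I_(q_ar R) -> expr) t ds d0 ds' d :
  d != \bot -> qinstances P R ->
  (forall i, qcrwl circ P Pi (Prod (es i) (q_lhs R i)) (ds i)) ->
  qcrwl circ P Pi (Prod (q_rhs R) t) d0 ->
  (forall j, qcrwl circ P Pi (Con (q_cond R j)) (ds' j)) ->
  (forall i, d <= ds i) ->
  d <= circ (q_att R) d0 ->
  (forall j, d <= circ (q_att R) (ds' j)) ->
  qcrwl circ P Pi (Prod (EDef (q_fun R) es) t) d.
Proof.
move=> *; have [tr|tr] := classic (trivial Pi (Prod (EDef (q_fun R) es) t)).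
  exact: QTI.
by apply: (QDF (ds := ds) (d0 := d0) (ds' := ds')).
Qed.

Lemma qcrwl_prim n (p : PF S n) (es : 'I_n -> expr) ts v d :
  d != \bot ->
  (forall i, qcrwl circ P Pi (Prod (es i) (ts i)) d) ->
  is_simple v -> entails_prod Pi p ts v ->
  qcrwl circ P Pi (Prod (EPrim p es) v) d.
Proof.
move=> *; have [tr|tr] := classic (trivial Pi (Prod (EPrim p es) v)).
  exact: QTI.
by apply: (QPF (ts := ts) (ds := fun=> d)).
Qed.

Lemma qcrwl_constr n (p : PF S n) (es : 'I_n -> expr) ts v d :
  d != \bot ->
  (forall i, qcrwl circ P Pi (Prod (es i) (ts i)) d) ->
  is_simple v -> entails Pi (prim_app p ts v) ->
  qcrwl circ P Pi (Con (Constr p es v)) d.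
Proof.
move=> *; have [tr|tr] := classic (trivial Pi (Con (Constr p es v))).
  exact: QTI.
by apply: (QAC (ts := ts) (ds := fun=> d)).
Qed.

End QDerivability.

(** * Derivability of instances of a conjunction of primitive constraints *)

Section PrimitiveConstraints.
Context (S : signature) (C : cdomain S) (F : nat -> Type) (V : eqType).
Context (P : crule C F V -> Prop) (Pi : seq (constr S (basic C) noDF V)).
Context (V0 : Type) (pc : seq (constr S (basic C) noDF V0)).

Lemma derivable_all_prim (s : V0 -> gterm S (basic C)) :
  gsol pc s ->
  derivable_all P Pi
    [seq csubst (fun x => of_gterm (s x)) (constr_of_prim c) | c <- pc].
Proof.
move=> sol _ /In_map[c /sol tc ->]; rewrite csubst_prim.
by have := crwl_constr_complete P Pi tc; rewrite csubst_comp.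
Qed.

(** Unlike in the converse above, the parameters may be non-ground; they are read under the solution
    [g]. *)
Lemma derivable_all_prim_sound (s : V0 -> term S (basic C) V) g :
  gsol Pi g ->
  derivable_all P Pi [seq csubst s (constr_of_prim c) | c <- pc] ->
  gsol pc (fun x => tsubst g (s x)).
Proof.
move=> sg H c pcc; rewrite -csubst_comp; apply: (crwl_constr_sound sg (P := P)).
by rewrite -csubst_prim; apply: H; apply/In_map; exists c.
Qed.

End PrimitiveConstraints.

(** * Qualification values and the constraints that express them *)

Section Qualifications.
Context (disp : Order.disp_t) (D : tbLatticeType disp) (circ : D -> D -> D).
Context (hD : is_qdomain circ).
Context (S : signature) (C : cdomain S) (X : expressible circ C).
Local Notation gterm := (gterm S (basic C)).

Lemma circ_bot d : circ d \bot = \bot.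
Proof.
apply/eqP; rewrite -lex0 -[leRHS](circ_top hD) (circC hD).
exact: (circ_monotone hD).
Qed.

Lemma circ_le d e : circ d e <= d.
Proof. by rewrite -[leRHS](circ_top hD); apply: (circ_monotone hD). Qed.

Lemma top_circ d : circ \top d = d.
Proof. by rewrite (circC hD) (circ_top hD). Qed.

Lemma le_neq0 (d e : D) : d <= e -> d != \bot -> e != \bot.
Proof. by move=> le; apply: contraNneq => e0; rewrite -lex0 -e0. Qed.

Lemma qval_gsol (u : gterm) :
  gsol (qval X) (fun=> u) <-> exists2 d, d != \bot & u = qterm X d.
Proof.
rewrite -(Sol_of_gterm (V := unit)).
rewrite (qval_spec X); last by move=> x _; exists u.
split=> -[d nd e]; exists d => //; last by rewrite e.
by rewrite -(tsubst_of_gtermK (fun x : unit => u) u) e tsubst_of_gtermK.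
Qed.

Lemma qbound_gsol x y z :
  x != \bot -> y != \bot -> z != \bot ->
  gsol (qbound X) (tnth [tuple qterm X x; qterm X y; qterm X z]) <->
  x <= circ y z.
Proof.
move=> nx ny nz; rewrite -(Sol_of_gterm (V := 'I_3)).
apply: qbound_spec => //; first by move=> i _; eexists.
all: by rewrite (tnth_nth (qterm X x)) inordK.
Qed.

(* By monotonicity of the primitives, qBound cannot tell a qualification from *)
(* a larger term, so the values representing D \ {b} are incomparable.        *)
Lemma qterm_tle d e :
  d != \bot -> e != \bot -> tle (qterm X d) (qterm X e) -> d = e.
Proof.
move=> nd ne le.
have nt : (\top : D) != \bot by apply: le_neq0 nd; apply: lex1.
have mono (a b : 'I_3 -> gterm) : (forall i, tle (a i) (b i)) ->
    gsol (qbound X) a -> gsol (qbound X) b.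
  by move=> ab sol c /sol; apply: ctrue_subst_tle.
have le3 (a b c a' b' c' : gterm) : tle a a' -> tle b b' -> tle c c' ->
    forall i, tle (tnth [tuple a; b; c] i) (tnth [tuple a'; b'; c'] i).
  by move=> h1 h2 h3 [[|[|[|//]]] i]; rewrite (tnth_nth a) (tnth_nth a').
(* Both inequalities grow the valid bound [d <= circ d \top]: putting [e] for the second argument
   yields [d <= e], putting it for the first yields [e <= d]. *)
apply: le_anti; apply/andP; split.
  rewrite -[leRHS](circ_top hD); apply/qbound_gsol => //.
  apply: mono (le3 _ _ _ _ _ _ (tle_refl _) le (tle_refl _)) _.
  by apply/qbound_gsol; rewrite // (circ_top hD).
rewrite -[leRHS](circ_top hD); apply/qbound_gsol => //.
apply: mono (le3 _ _ _ _ _ _ le (tle_refl _) (tle_refl _)) _.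
by apply/qbound_gsol; rewrite // (circ_top hD).
Qed.

Context (F : nat -> Type).
Local Notation qVal := (qVal X F).
Local Notation qBound := (qBound X F).
Local Notation qLe := (qLe X F).
Local Notation qFamily := (qFamily X F).
Local Notation dv := (dv X).
Implicit Types Th : subst S (basic C) tvar.

Lemma map_qVal Th t : map (csubst Th) (qVal t) = qVal (tsubst Th t).
Proof. by rewrite -map_comp; apply: eq_map => c /=; rewrite csubst_comp. Qed.

Lemma map_qBound Th t1 t2 t3 :
  map (csubst Th) (qBound t1 t2 t3) =
  qBound (tsubst Th t1) (tsubst Th t2) (tsubst Th t3).
Proof.
rewrite -map_comp; apply: eq_map => c /=; rewrite csubst_comp.
congr csubst; apply: functional_extensionality => i.
by case: i => [[|[|[]]]] //= i; rewrite !(tnth_nth t1).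
Qed.

Context (P : crule C (DFT F) tvar -> Prop).
Context (Pi : seq (constr S (basic C) noDF tvar)).
Local Notation der := (derivable_all P Pi).

Lemma der_qVal d : d != \bot -> der (qVal (dv d)).
Proof.
move=> nd; have /qval_gsol : exists2 e, e != \bot & qterm X d = qterm X e.
  by exists d.
exact: derivable_all_prim.
Qed.

Lemma der_qBound x y z : x != \bot -> y != \bot -> z != \bot ->
  x <= circ y z -> der (qBound (dv x) (dv y) (dv z)).
Proof.
move=> nx ny nz /(qbound_gsol nx ny nz) /(derivable_all_prim P Pi).
rewrite /Defs.qBound; congr (der _); apply: eq_map => c; congr csubst.
apply: functional_extensionality => i.
by case: i => [[|[|[]]]] //= i; rewrite !(tnth_nth (dv x)) (tnth_nth (qterm X x)).
Qed.

Lemma der_qLe x y : x != \bot -> x <= y -> der (qLe (dv x) (dv y)).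
Proof.
move=> nx xy; have ny := le_neq0 xy nx.
by apply: der_qBound; rewrite ?top_circ //; apply: le_neq0 nx; apply: lex1.
Qed.

(** The bound [r w <= a] is what an empty family asserts; it also shows that [a] is not bottom, as
    [qBound] requires. *)
Lemma der_qFamily Th r w a ws :
  r w != \bot -> r w <= a -> {in w :: ws, forall v, Th (inW v) = dv (r v)} ->
  {in ws, forall v, r w <= circ a (r v)} ->
  der (map (csubst Th) (qFamily w a ws)).
Proof.
move=> nw wa Er le; have Ew : Th (inW w) = dv (r w) by apply: Er; rewrite mem_head.
have na := le_neq0 wa nw.
have E v : tsubst Th (dv v) = dv v by exact: tsubst_of_gterm.
case: ws Er le => [|v0 ws] Er le; rewrite /Defs.qFamily.
  by rewrite map_qBound /= Ew !E; apply: der_qLe.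
rewrite map_flatten -map_comp; apply/derivable_all_flatten => v wsv.
have lev := le v wsv; have Ev : Th (inW v) = dv (r v).
  by apply: Er; rewrite inE wsv orbT.
rewrite /= map_qBound /= Ew Ev E; apply: der_qBound => //.
(* [circ a (r v)] lies below [r v], which therefore is not bottom. *)
by apply: le_neq0 nw; apply: le_trans lev _; rewrite (circC hD) circ_le.
Qed.

Context (g : tvar -> gterm) (sg : gsol Pi g).

Lemma der_qVal_sound t :
  der (qVal t) -> exists2 d, d != \bot & tsubst g t = qterm X d.
Proof. by move/(derivable_all_prim_sound sg)/qval_gsol. Qed.

Lemma der_qBound_sound t1 t2 t3 x y z :
  der (qBound t1 t2 t3) -> x != \bot -> y != \bot -> z != \bot ->
  tsubst g t1 = qterm X x -> tsubst g t2 = qterm X y ->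
  tsubst g t3 = qterm X z -> x <= circ y z.
Proof.
move=> /(derivable_all_prim_sound sg) H nx ny nz e1 e2 e3.
apply/qbound_gsol => //; move: H; congr (gsol _ _).
apply: functional_extensionality => i; rewrite -e1 -e2 -e3.
by case: i => [[|[|[]]]] //= i; rewrite !(tnth_nth t1) (tnth_nth (tsubst g t1)).
Qed.

Lemma der_qLe_sound t1 t2 x y :
  der (qLe t1 t2) -> x != \bot -> y != \bot ->
  tsubst g t1 = qterm X x -> tsubst g t2 = qterm X y -> x <= y.
Proof.
move=> H nx ny e1 e2; rewrite -(top_circ y).
apply: (der_qBound_sound H) => //; last exact: tsubst_of_gtermK.
by apply: le_neq0 nx; apply: lex1.
Qed.

(** Attenuation distributes over meets, so the bounds for the single variables combine into one for
    the meet [d'] of their values. This [d'] then qualifies the whole expression whose top-level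
    variables are [ws]. *)
Lemma der_qFamily_sound Th w a ws d :
  a != \bot -> d != \bot ->
  der (map (csubst Th) (qFamily w a ws)) -> tsubst g (Th (inW w)) = qterm X d ->
  {in ws, forall v, exists2 e, e != \bot & tsubst g (Th (inW v)) = qterm X e} ->
  exists d', [/\ d' != \bot, d <= circ a d' &
    {in ws, forall v, exists2 e, d' <= e & tsubst g (Th (inW v)) = qterm X e}].
Proof.
move=> na nd H ew val.
have E b : tsubst Th (dv b) = dv b by exact: tsubst_of_gterm.
have K b : tsubst g (dv b) = qterm X b by exact: tsubst_of_gtermK.
suff [d' [le dom]] : exists d', d <= circ a d' /\
    {in ws, forall v, exists2 e, d' <= e & tsubst g (Th (inW v)) = qterm X e}.
  (* If [d'] were bottom, so would be [circ a d'] and hence [d]. *)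
  exists d'; split=> //; apply: contraNneq nd => d0.
  by rewrite -lex0 -(circ_bot a) -d0.
have {H val} [le0 val] : d <= a /\ {in ws, forall v, exists2 e,
    d <= circ a e & tsubst g (Th (inW v)) = qterm X e}.
  case: ws val H => [|v0 ws] val; rewrite /Defs.qFamily.
    rewrite map_qBound !E => H; split=> //.
    exact: (der_qLe_sound H).
  rewrite map_flatten -map_comp => /derivable_all_flatten H.
  suff val' : {in v0 :: ws, forall v, exists2 e,
      d <= circ a e & tsubst g (Th (inW v)) = qterm X e}.
    split=> //; have [e le _] := val' _ (mem_head _ _).
    by apply: le_trans le _; apply: circ_le.
  move=> v wsv; have [e ne ev] := val v wsv; exists e => //.
  have := H v wsv; rewrite /= map_qBound E => Hv.
  exact: (der_qBound_sound Hv).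
(* The empty meet is [\top], where the bound reads [d <= a]; this is why [le0] was extracted for
   nonempty families too. *)
elim: ws val => [|v ws IH] val; first by exists \top; rewrite (circ_top hD).
have [|d1 [le1 dom1]] := IH; first by move=> u uws; apply: val; rewrite inE uws orbT.
have [e le ev] := val _ (mem_head _ _).
exists (e `&` d1); rewrite (circ_meet hD) lexI le le1; split=> // u.
rewrite inE => /predU1P[->|/dom1[e' le' eu]]; first by exists e; rewrite // leIl.
by exists e' => //; apply: le_trans le'; rewrite leIr.
Qed.

End Qualifications.

(** * Inversion, locality and instances of transforms *)

Section Transforms.
Context (disp : Order.disp_t) (D : tbLatticeType disp) (circ : D -> D -> D).
Context (hD : is_qdomain circ).
Context (S : signature) (C : cdomain S) (X : expressible circ C).
Context (F : nat -> Type).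
Local Notation sexpr := (expr S (basic C) F svar).
Local Notation texpr := (expr S (basic C) (DFT F) tvar).
Local Notation trExpr := (@trExpr _ D circ S C X F).
Local Notation trConstr := (@trConstr _ D circ S C X F).
Local Notation transf := (transf C F).
Local Notation qVal := (qVal X F).
Local Notation dv := (dv X).
Implicit Types Th : subst S (basic C) tvar.

Lemma trExpr_inv e tr : trExpr e tr ->
  match e with
  | EBot => tr = Transf EBot [::] [::] [::]
  | EVar x => tr = Transf (EVar (inV x)) [::] [::] [::]
  | EBas u => tr = Transf (EBas u) [::] [::] [::]
  | ECon n c es => exists2 rs : 'I_n -> transf texpr,
      forall i, trExpr (es i) (rs i) &
      tr = Transf (ECon c (fun i => tr_obj (rs i)))
                  (bigcat (fun i => tr_omega (rs i)))
                  (bigcat (fun i => tr_qvars (rs i)))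
                  (bigcat (fun i => tr_new (rs i)))
  | EPrim n p es => exists2 rs : 'I_n -> transf texpr,
      forall i, trExpr (es i) (rs i) &
      tr = Transf (EPrim p (fun i => tr_obj (rs i)))
                  (bigcat (fun i => tr_omega (rs i)))
                  (bigcat (fun i => tr_qvars (rs i)))
                  (bigcat (fun i => tr_new (rs i)))
  | EDef n f es => exists (rs : 'I_n -> transf texpr) w,
      (forall i, trExpr (es i) (rs i)) /\
      tr = Transf
             (EDef (f : DFT F n.+1)
                   (snoc (fun i => tr_obj (rs i)) (EVar (inW w))))
             (bigcat (fun i => tr_omega (rs i)) ++ qVal (wv C w) ++
              flatten [seq qLe X F (wv C w) (wv C w')
                      | w' <- bigcat (fun i => tr_qvars (rs i))])
             [:: w] (w :: bigcat (fun i => tr_new (rs i)))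
  end.
Proof.
case=> // {e tr} [n c es rs H|n p es rs H|n f es rs w H].
- by exists rs.
- by exists rs.
- by exists rs, w.
Qed.

Lemma trConstr_inv c tr : trConstr c tr ->
  exists2 rs : 'I_(c_ar c) -> transf texpr,
    forall i, trExpr (c_args c i) (rs i) &
    tr = Transf (Constr (c_pf c) (fun i => tr_obj (rs i)) (trename inV (c_rhs c)))
                (bigcat (fun i => tr_omega (rs i)))
                (bigcat (fun i => tr_qvars (rs i)))
                (bigcat (fun i => tr_new (rs i))).
Proof. by case=> n p es v rs H; exists rs. Qed.

Lemma trExpr_qvars_new e tr : trExpr e tr -> {subset tr_qvars tr <= tr_new tr}.
Proof.
elim=> //= {e tr} [n c es rs _|n p es rs _|n f es rs w _ _ x]; try exact: sub_bigcat.
by rewrite !inE => ->.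
Qed.

Lemma trConstr_qvars_new c tr :
  trConstr c tr -> {subset tr_qvars tr <= tr_new tr}.
Proof.
case/trConstr_inv=> rs H -> /=; apply: sub_bigcat => i.
exact: trExpr_qvars_new (H i).
Qed.

Lemma map_qLes Th w (ws : seq qvar) :
  map (csubst Th) (flatten [seq qLe X F (wv C w) (wv C w') | w' <- ws]) =
  flatten [seq qLe X F (Th (inW w)) (Th (inW w')) | w' <- ws].
Proof.
rewrite map_flatten -map_comp; congr flatten; apply: eq_map => v /=.
by rewrite map_qBound tsubst_of_gterm.
Qed.

(** The constraints of a transform mention only its new qualification variables, and its expression
    mentions source variables besides. This locality lets values chosen for different subexpressions
    be glued. *)
Lemma trExpr_agree e tr Th Th' :
  trExpr e tr -> {in tr_new tr, forall w, Th (inW w) = Th' (inW w)} ->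
  map (csubst Th) (tr_omega tr) = map (csubst Th') (tr_omega tr) /\
  ((forall x, Th (inV x) = Th' (inV x)) ->
   esubst Th (tr_obj tr) = esubst Th' (tr_obj tr)).
Proof.
elim=> {e tr} [|x|u|n c es rs T IH|n p es rs T IH|n f es rs w T IH] //= E.
- by split=> // ->.
- split=> [|EV]; last first.
    apply: f_equal; apply: functional_extensionality => i.
    by apply: (IH i _).2 EV => v vi; apply: E; apply/mem_bigcat; exists i.
  rewrite !map_bigcat; apply: eq_bigcat => i; apply: (IH i _).1 => v vi.
  by apply: E; apply/mem_bigcat; exists i.
- split=> [|EV]; last first.
    apply: f_equal; apply: functional_extensionality => i.
    by apply: (IH i _).2 EV => v vi; apply: E; apply/mem_bigcat; exists i.
  rewrite !map_bigcat; apply: eq_bigcat => i; apply: (IH i _).1 => v vi.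
  by apply: E; apply/mem_bigcat; exists i.
have Ew : Th (inW w) = Th' (inW w) by apply: E; rewrite mem_head.
have Ei i : {in tr_new (rs i), forall v, Th (inW v) = Th' (inW v)}.
  move=> v vi; apply: E; rewrite inE; apply/orP; right.
  by apply/mem_bigcat; exists i.
split=> [|EV]; last first.
  apply: f_equal; rewrite !snoc_comp /= Ew; congr snoc.
  by apply: functional_extensionality => i; apply: (IH i (Ei i)).2 EV.
rewrite !map_cat !map_qVal !map_qLes /= Ew; congr (_ ++ (_ ++ _)).
  by rewrite !map_bigcat; apply: eq_bigcat => i; apply: (IH i (Ei i)).1.
congr flatten; apply/eq_in_map => v /mem_bigcat[i vi].
by rewrite (Ei i v (trExpr_qvars_new (T i) vi)).
Qed.

Lemma trConstr_agree c tr Th Th' :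
  trConstr c tr -> {in tr_new tr, forall w, Th (inW w) = Th' (inW w)} ->
  map (csubst Th) (tr_omega tr) = map (csubst Th') (tr_omega tr) /\
  ((forall x, Th (inV x) = Th' (inV x)) ->
   csubst Th (tr_obj tr) = csubst Th' (tr_obj tr)).
Proof.
case/trConstr_inv=> rs T -> /= E.
have Ei i : {in tr_new (rs i), forall v, Th (inW v) = Th' (inW v)}.
  by move=> v vi; apply: E; apply/mem_bigcat; exists i.
split=> [|EV].
  rewrite !map_bigcat; apply: eq_bigcat => i.
  exact: (trExpr_agree (T i) (Ei i)).1.
rewrite /csubst /=; congr Constr.
  apply: functional_extensionality => i.
  exact: (trExpr_agree (T i) (Ei i)).2 EV.
rewrite /trename !tsubst_comp; congr tsubst.
by apply: functional_extensionality => x; apply: EV.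
Qed.

Lemma trExpr_term (t : term S (basic C) svar) :
  trExpr (expr_of_term t)
         (Transf (expr_of_term (trename inV t)) [::] [::] [::]).
Proof.
elim: t => [|x|u|n c ts IH] /=; try by constructor.
by have := tr_con c IH; rewrite /= !bigcat_nil.
Qed.

(** A substitution inserts terms, which contain no calls and so bring in no new qualification
    variable. Hence transforms of rule instances are instances of transforms of rules. *)
Lemma trExpr_subst (th : subst S (basic C) svar) e tr :
  trExpr e tr ->
  trExpr (esubst th e)
    (Transf (esubst (subst_sum th TVar) (tr_obj tr))
            (tr_omega tr) (tr_qvars tr) (tr_new tr)).
Proof.
elim=> {e tr} [|x|u|n c es rs _ IH|n p es rs _ IH|n f es rs w _ IH] /=;
  try by constructor.
- exact: trExpr_term.
- exact: (tr_con c IH).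
- exact: (tr_prim p IH).
by rewrite snoc_comp; apply: (tr_def f w IH).
Qed.

Lemma trConstr_subst (th : subst S (basic C) svar) c tr :
  trConstr c tr ->
  trConstr (csubst th c)
    (Transf (csubst (subst_sum th TVar) (tr_obj tr))
            (tr_omega tr) (tr_qvars tr) (tr_new tr)).
Proof.
case/trConstr_inv=> rs T ->; rewrite /csubst /= trename_subst_sum.
exact: (tr_constr (c_pf c) _ (fun i => trExpr_subst th (T i))).
Qed.

(** * From source derivations to target derivations *)

Section Forward.
Context (P : qrule D C F svar -> Prop) (P' : crule C (DFT F) tvar -> Prop).
Context (Pi : seq (constr S (basic C) noDF svar)).
Context (hP' : forall R, P R -> exists2 R', P' R' & trRule X R R').
Let Pi' : seq (constr S (basic C) noDF tvar) := [seq crename inV c | c <- Pi].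
Local Notation der := (derivable_all P' Pi').

Lemma gsol_crename g : gsol Pi' g <-> gsol Pi (fun x => g (inV x)).
Proof.
split=> [H c Pic|H _ /In_map[c /H tc ->]]; last by rewrite csubst_comp.
have : List.In (crename inV c) Pi' by apply/In_map; exists c.
by move=> /H; rewrite csubst_comp.
Qed.

Lemma Unsat_crename : Unsat Pi' <-> Unsat Pi.
Proof.
rewrite !Unsat_gsol; split=> N [g sg]; apply: N; last first.
  by exists (fun x => g (inV x)); apply/gsol_crename.
(* Qualification variables do not occur in the renamed constraints, so any value serves for them. *)
by exists (fun x => if x is inl y then g y else TBot); apply/gsol_crename.
Qed.

Definition inst (th : subst S (basic C) svar) (r : qvar -> D) :
    subst S (basic C) tvar :=
  fun x => match x with
           | inl y => trename inV (th y)
           | inr w => dv (r w)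
           end.

Lemma tsubst_inst th r t :
  tsubst (inst th r) (trename inV t) = trename inV (tsubst th t).
Proof. by rewrite /trename !tsubst_comp. Qed.

Lemma inst_subst_sum th r x :
  tsubst (inst TVar r) (subst_sum th TVar x) = inst th r x.
Proof. by case: x => //= y; rewrite tsubst_inst tsubst_id. Qed.

(** The invariant of the forward induction. The values of the top-level variables are bounded below
    because a surrounding call, rule or goal compares exactly these with its own variable. *)
Definition realizes Th (r : qvar -> D) T (tr : transf T) d psi : Prop :=
  [/\ der (map (csubst Th) (tr_omega tr)),
      {in tr_qvars tr, forall w, d <= r w}
    & crwl P' Pi' psi].

Lemma join_realizers n (s : 'I_n -> seq qvar) (Q : 'I_n -> (qvar -> D) -> Prop)
    (r0 : qvar -> D) :
  (forall i r r', {in s i, r =1 r'} -> Q i r -> Q i r') ->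
  uniq (bigcat s) ->
  (forall w, r0 w != \bot) ->
  (forall i, exists2 r, forall w, r w != \bot & Q i r) ->
  exists r, [/\ forall w, r w != \bot, forall i, Q i r &
                forall w, w \notin bigcat s -> r w = r0 w].
Proof.
move=> congQ U n0 /fin_all_exists2[rs ns Qs].
have [r [rE r0E]] := join_functions rs r0 U; exists r; split=> // [w|i].
  have [/mem_bigcat[i wi]|/r0E->//] := boolP (w \in bigcat s).
  by rewrite (rE i).
by apply: congQ (Qs i) => w wi; rewrite (rE i).
Qed.

(** For trivial statements, which have no subderivations to supply values: the constraints only
    compare new variables with each other, so a constant assignment satisfies them. *)
Lemma const_realizes e tr d :
  d != \bot -> trExpr e tr ->
  der (map (csubst (inst TVar (fun=> d))) (tr_omega tr)).
Proof.
move=> nd; elim=> {e tr} [|x|u|n c es rs _ IH|n p es rs _ IH|n f es rs w _ IH] //=.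
- by rewrite map_bigcat; apply/derivable_all_bigcat.
- by rewrite map_bigcat; apply/derivable_all_bigcat.
rewrite !map_cat map_bigcat map_qVal /=; apply/derivable_all_cat; split.
  exact/derivable_all_bigcat.
apply/derivable_all_cat; split; first exact: der_qVal.
rewrite map_qLes; apply/derivable_all_flatten => v _ /=.
exact: (der_qLe hD).
Qed.

(** Quantifying over the transforms makes the induction hypothesis available for whichever fresh
    variables the surrounding expression or rule has chosen. *)
Definition forward (psi : stmt S (basic C) F svar) (d : D) : Prop :=
  match psi with
  | Prod e t => forall tr, trExpr e tr -> uniq (tr_new tr) ->
      exists2 r, forall w, r w != \bot &
        realizes (inst TVar r) r tr d
                 (Prod (esubst (inst TVar r) (tr_obj tr)) (trename inV t))
  | Con c => forall tr, trConstr c tr -> uniq (tr_new tr) ->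
      exists2 r, forall w, r w != \bot &
        realizes (inst TVar r) r tr d (Con (csubst (inst TVar r) (tr_obj tr)))
  end.

Lemma inst_agree th th' r r' (s : seq qvar) :
  {in s, r =1 r'} -> {in s, forall w, inst th r (inW w) = inst th' r' (inW w)}.
Proof. by move=> E w ws /=; rewrite E. Qed.

Lemma realizes_expr e tr th d r r' t :
  trExpr e tr -> {in tr_new tr, r =1 r'} ->
  realizes (inst th r) r tr d (Prod (esubst (inst th r) (tr_obj tr)) t) ->
  realizes (inst th r') r' tr d (Prod (esubst (inst th r') (tr_obj tr)) t).
Proof.
move=> T E [O le H]; have [EO EO'] := trExpr_agree T (inst_agree th th E).
split; first by rewrite -EO.
  by move=> w ws; rewrite -E ?le // (trExpr_qvars_new T).
by rewrite -EO'.
Qed.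

Lemma realizes_constr c tr th d r r' :
  trConstr c tr -> {in tr_new tr, r =1 r'} ->
  realizes (inst th r) r tr d (Con (csubst (inst th r) (tr_obj tr))) ->
  realizes (inst th r') r' tr d (Con (csubst (inst th r') (tr_obj tr))).
Proof.
move=> T E [O le H]; have [EO EO'] := trConstr_agree T (inst_agree th th E).
split; first by rewrite -EO.
  by move=> w ws; rewrite -E ?le // (trConstr_qvars_new T).
by rewrite -EO'.
Qed.

(** The hypothesis concerns the instance of [e] used in the source derivation; it is read back as a
    statement on the transform of [e] itself, as it occurs in the transformed rule. *)
Lemma forward_expr th e t d tr :
  forward (Prod (esubst th e) t) d -> trExpr e tr -> uniq (tr_new tr) ->
  exists2 r, forall w, r w != \bot &
    realizes (inst th r) r tr d
             (Prod (esubst (inst th r) (tr_obj tr)) (trename inV t)).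
Proof.
move=> fw T U; have [r nr [O le H]] := fw _ (trExpr_subst th T) U.
exists r => //; split=> //; last first.
  move: H; rewrite /= esubst_comp; congr (crwl _ _ (Prod (esubst _ _) _)).
  by apply: functional_extensionality => x; apply: inst_subst_sum.
by move: O; rewrite /= (trExpr_agree (Th' := inst th r) T _).1.
Qed.

Lemma forward_constr th c d tr :
  forward (Con (csubst th c)) d -> trConstr c tr -> uniq (tr_new tr) ->
  exists2 r, forall w, r w != \bot &
    realizes (inst th r) r tr d (Con (csubst (inst th r) (tr_obj tr))).
Proof.
move=> fw T U; have [r nr [O le H]] := fw _ (trConstr_subst th T) U.
exists r => //; split=> //; last first.
  move: H; rewrite /= csubst_comp; congr (crwl _ _ (Con (csubst _ _))).
  by apply: functional_extensionality => x; apply: inst_subst_sum.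
by move: O; rewrite /= (trConstr_agree (Th' := inst th r) T _).1.
Qed.

(** The value [d] outside the variables of the arguments provides for the variable of the enclosing
    call. *)
Lemma forward_args n (es : 'I_n -> sexpr) (rs : 'I_n -> transf texpr) ts ds d :
  d != \bot ->
  (forall i, forward (Prod (es i) (ts i)) (ds i)) -> (forall i, d <= ds i) ->
  (forall i, trExpr (es i) (rs i)) -> uniq (bigcat (fun i => tr_new (rs i))) ->
  exists r, [/\ forall w, r w != \bot,
    forall i, realizes (inst TVar r) r (rs i) d
      (Prod (esubst (inst TVar r) (tr_obj (rs i))) (trename inV (ts i))) &
    forall w, w \notin bigcat (fun i => tr_new (rs i)) -> r w = d].
Proof.
move=> nd fw le T U; apply: (join_realizers _ U) => [i r r'||i] //.
  exact: realizes_expr (T i).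
have [r nr [O ler H]] := fw i _ (T i) ((uniq_bigcat U).1 i).
by exists r => //; split=> // w /ler; apply: le_trans.
Qed.

Lemma realizes_bigcat Th r n T (rs : 'I_n -> transf T) d psi :
  (forall i, realizes Th r (rs i) d (psi i)) ->
  der (map (csubst Th) (bigcat (fun i => tr_omega (rs i)))) /\
  {in bigcat (fun i => tr_qvars (rs i)), forall w, d <= r w}.
Proof.
move=> H; split=> [|w /mem_bigcat[i wi]]; last by case: (H i) => _ + _; apply.
by rewrite map_bigcat; apply/derivable_all_bigcat => i; case: (H i).
Qed.

(** The transformed rule is instantiated by [th] on source variables, by the value [d] of the call
    on its own variable, and by the values from the induction hypotheses on the variables of its
    body and conditions. *)
Lemma forward_rule R R' :
  trRule X R R' -> forall th (es : 'I_(q_ar R) -> texpr) t d d0 ds,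
  P' R' -> d != \bot ->
  (forall i, crwl P' Pi' (Prod (es i) (trename inV (tsubst th (q_lhs R i))))) ->
  forward (Prod (esubst th (q_rhs R)) t) d0 ->
  (forall j, forward (Con (csubst th (q_cond R j))) (ds j)) ->
  d <= circ (q_att R) d0 -> (forall j, d <= circ (q_att R) (ds j)) ->
  crwl P' Pi' (Prod (EDef (q_fun R : DFT F (q_ar R).+1)
                          (snoc es (expr_of_term (dv d))))
                    (trename inV t)).
Proof.
case=> {R R'} n f lhs a rhs m deltas w tr trs T Ts U th es t d d0 ds /=.
move=> PR' nd Hes fw0 fws le0 les.
move: U; rewrite cons_uniq cat_uniq => /and4P[nw U /hasPn disj Us].
have [r0 nr0 H0] := forward_expr fw0 T U.
(* Base values for the gluing, which overrides them on the variables of the conditions only. *)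
pose r1 v := if v == w then d else r0 v.
have nr1 v : r1 v != \bot by rewrite /r1; case: ifP.
have [|i|r [nr H rE]] := join_realizers (Q := fun j r =>
    realizes (inst th r) r (trs j) (ds j)
             (Con (csubst (inst th r) (tr_obj (trs j))))) _ Us nr1.
- by move=> j r r'; apply: realizes_constr (Ts j).
- exact: forward_constr (fws i) (Ts i) ((uniq_bigcat Us).1 i).
have rw : r w = d.
  rewrite rE ?/r1 ?eqxx //.
  by move: nw; rewrite mem_cat negb_or => /andP[].
have {}H0 : realizes (inst th r) r tr d0
    (Prod (esubst (inst th r) (tr_obj tr)) (trename inV t)).
  apply: realizes_expr T _ H0 => v vn; rewrite rE; last first.
    by apply/negP => /disj; rewrite vn.
  rewrite /r1; case: eqP => // e; case/negP: nw.
  by rewrite -e mem_cat vn.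
have fam e ws : d <= circ a e -> {in ws, forall v, e <= r v} ->
    der (map (csubst (inst th r)) (qFamily X F w a ws)).
  move=> lee lews; apply: (der_qFamily hD P' Pi' (r := r)) => //.
    by rewrite rw; apply: le_trans lee _; apply: circ_le.
  move=> v /lews lev; rewrite rw; apply: le_trans lee _.
  exact: (circ_monotone hD).
have [O0 le0' C0] := H0.
pose R' := CRule (C := C) (f : DFT F n.+1)
  (snoc (fun i => trename inV (lhs i)) (wv C w)) (tr_obj tr)
  (qVal (wv C w) ++ tr_omega tr ++ qFamily X F w a (tr_qvars tr) ++
   bigcat (fun j => tr_omega (trs j) ++ qFamily X F w a (tr_qvars (trs j)) ++
                    [:: tr_obj (trs j)])).
apply: (crwl_def (R := crule_subst (inst th r) R')) => //.
- by exists R' => //; exists (inst th r).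
- move=> i; rewrite /= /snoc; case: unlift => [j|] /=.
    by rewrite tsubst_inst.
  by rewrite rw; apply: crwl_term_refl.
suff : der (r_conds (crule_subst (inst th r) R')) by [].
rewrite /= !map_cat; apply/derivable_all_cat; split.
  by rewrite map_qVal; apply: der_qVal; apply: nr.
apply/derivable_all_cat; split=> //; apply/derivable_all_cat; split.
  exact: fam le0 _.
rewrite map_bigcat; apply/derivable_all_bigcat => j; have [O le' c] := H j.
rewrite !map_cat; apply/derivable_all_cat; split=> //.
apply/derivable_all_cat; split; first exact: fam (les j) _.
exact/derivable_all1.
Qed.

Lemma qcrwl_forward psi d : qcrwl circ P Pi psi d -> forward psi d.
Proof.
elim=> {psi d} [[e t|c] d nd wf [U|[e' E]]|v d nd _ hv|
  n c es ts ds d nd _ _ IH le|R es t ds d0 ds' d nd _ HR _ IH _ IH0 _ IHc le le0 lec|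
  n p es ts v ds d nd _ _ IH hv ent le|n p es ts v ds d nd _ _ IH hv ent le] //=.
- move=> tr T _; exists (fun=> d) => //; split=> //; first exact: const_realizes T.
  by apply: TI => //; left; apply/Unsat_crename.
- case: E => _ ->.
  move=> tr T _; exists (fun=> d) => //; split=> //; first exact: const_realizes T.
  exact: crwl_bot.
- move=> tr /trConstr_inv[rs T ->] _ /=.
  exists (fun=> d) => //; split=> //=.
    rewrite map_bigcat; apply/derivable_all_bigcat => i.
    exact: const_realizes (T i).
  apply: TI; last by left; apply/Unsat_crename.
  by rewrite /= /atomic /= tsubst_inst is_simple_trename tsubst_id.
- move=> tr T _; exists (fun=> d) => //.
  case: v hv T => //= z _ /trExpr_inv ->; split=> //.
    exact: (crwl_term_refl P' Pi' (TVar (inV z))).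
  exact: (crwl_term_refl P' Pi' (TBas z)).
- move=> tr /trExpr_inv[rs T ->] /= U.
  have [r [nr H _]] := forward_args nd IH le T U; exists r => //.
  have [O leq] := realizes_bigcat H; split=> //.
  by apply: crwl_con => i; case: (H i).
- case: HR => R0 PR0 [th ER]; subst R.
  have [R0' PR0' tR] := hP' PR0.
  move=> tr /trExpr_inv[rs [w [T ->]]] /= /andP[nw U].
  have [r [nr H rE]] := forward_args nd IH le T U; exists r => //.
  (* Freshness of [w] makes its value the qualification [d] of the call. *)
  have [O leq] := realizes_bigcat H; have rw := rE w nw.
  split=> /=; last 1 first.
  + rewrite snoc_comp /= rw.
    apply: (forward_rule tR PR0' nd _ IH0 IHc le0 lec) => i.
    by case: (H i).
  + rewrite !map_cat map_qVal; apply/derivable_all_cat; split=> //.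
    apply/derivable_all_cat; split; first exact: der_qVal.
    rewrite map_qLes; apply/derivable_all_flatten => v vs /=.
    apply: (der_qLe hD) => //.
    by rewrite rw leq.
  + by move=> v; rewrite inE => /eqP ->; rewrite rw.
- move=> tr /trExpr_inv[rs T ->] /= U.
  have [r [nr H _]] := forward_args nd IH le T U; exists r => //.
  have [O leq] := realizes_bigcat H; split=> //=.
  apply: (crwl_prim (ts := fun i => trename inV (ts i))).
  + by move=> i; case: (H i).
  + by rewrite is_simple_trename.
  apply/entails_prod_gsol => g /gsol_crename sg.
  have := (entails_prod_gsol _ _ _ _).1 ent _ sg.
  rewrite /trename tsubst_comp; congr interp.
  by apply: functional_extensionality => i; rewrite tsubst_comp.
move=> tr /trConstr_inv[rs T ->] /= U.
have [r [nr H _]] := forward_args nd IH le T U; exists r => //.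
have [O leq] := realizes_bigcat H; split=> //=.
rewrite /csubst /= tsubst_inst tsubst_id.
apply: (crwl_constr (ts := fun i => trename inV (ts i))).
- by move=> i; case: (H i).
- by rewrite is_simple_trename.
apply/entails_gsol => g /gsol_crename sg.
have := (entails_gsol _ _).1 ent _ sg.
rewrite /csubst /= /trename tsubst_comp; congr (ctrue (Constr _ _ _)).
by apply: functional_extensionality => i; rewrite !esubst_term tsubst_comp.
Qed.
End Forward.
End Transforms.

(** * From target derivations to source derivations *)

Section Backward.
Context (disp : Order.disp_t) (D : tbLatticeType disp) (circ : D -> D -> D).
Context (hD : is_qdomain circ).
Context (S : signature) (C : cdomain S) (X : expressible circ C).
Context (F : nat -> Type).
Local Notation sterm := (term S (basic C) svar).
Local Notation sexpr := (expr S (basic C) F svar).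
Local Notation sconstr := (constr S (basic C) F svar).
Local Notation tterm := (term S (basic C) tvar).
Local Notation texpr := (expr S (basic C) (DFT F) tvar).
Local Notation tconstr := (constr S (basic C) (DFT F) tvar).
Local Notation qVal := (qVal X F).
Implicit Types Th : subst S (basic C) tvar.
Context (P : qrule D C F svar -> Prop) (P' : crule C (DFT F) tvar -> Prop).
Context (hP : qprogram_wf P).
Context (hP' : forall R', P' R' -> exists2 R, P R & trRule X R R').
Context (Pi : seq (constr S (basic C) noDF svar)).
Let Pi' : seq (constr S (basic C) noDF tvar) := [seq crename inV c | c <- Pi].
Local Notation der := (derivable_all P' Pi').

(* Target terms may contain qualification variables anywhere; sending them to *)
(* bot is sound because Pi does not constrain them.                           *)
Definition erase_var (x : tvar) : sterm :=
  match x with inl y => TVar y | inr _ => TBot end.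

(** The match exposes that target symbols have positive arity; the last argument, which carries the
    qualification, is dropped. *)
Definition erase_def n : DFT F n -> ('I_n -> sexpr) -> sexpr :=
  match n with
  | 0 => fun f _ => match f with end
  | n'.+1 => fun f es => EDef (f : F n') (fun i => es (lift ord_max i))
  end.

Fixpoint erase (e : texpr) : sexpr :=
  match e with
  | EBot => EBot
  | EVar x => expr_of_term (erase_var x)
  | EBas u => EBas u
  | ECon n c es => ECon c (fun i => erase (es i))
  | EPrim n p es => EPrim p (fun i => erase (es i))
  | EDef n f es => erase_def f (fun i => erase (es i))
  end.

Definition erase_constr (c : tconstr) : sconstr :=
  Constr (c_pf c) (fun i => erase (c_args c i)) (tsubst erase_var (c_rhs c)).

Lemma erase_term (t : tterm) :
  erase (expr_of_term t) = expr_of_term (tsubst erase_var t).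
Proof.
elim: t => //= n c ts IH; apply: f_equal; exact: functional_extensionality.
Qed.

Lemma erase_transform Th e tr : trExpr X e tr ->
  erase (esubst Th (tr_obj tr)) =
  esubst (fun x => tsubst erase_var (Th (inV x))) e.
Proof.
elim=> {e tr} [|x|u|n c es rs _ IH|n p es rs _ IH|n f es rs w _ IH] //=.
- exact: erase_term.
- by apply: f_equal; apply: functional_extensionality.
- by apply: f_equal; apply: functional_extensionality.
by apply: f_equal; apply: functional_extensionality => i; rewrite snoc_lift.
Qed.

Lemma erase_constr_transform Th c tr : trConstr X c tr ->
  erase_constr (csubst Th (tr_obj tr)) =
  csubst (fun x => tsubst erase_var (Th (inV x))) c.
Proof.
case/trConstr_inv=> rs T ->; rewrite /erase_constr /csubst /=; congr Constr.
  by apply: functional_extensionality => i; apply: erase_transform.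
by rewrite /trename !tsubst_comp.
Qed.

(* The term in the qualification argument of a call need not be ground, so it *)
(* is measured by its value under a fixed solution g of Pi.                   *)
Context (g : tvar -> gterm S (basic C)) (sg : gsol Pi' g).

(** [d] bounds the outermost calls from below, and the value [d'] of a call in turn bounds those
    nested in its arguments. The test [i.+1 == n] singles out the last argument. *)
Fixpoint qualified (e : texpr) (d : D) : Prop :=
  match e with
  | ECon n _ es | EPrim n _ es => forall i, qualified (es i) d
  | EDef n _ es => exists2 d', d <= d' &
      forall i : 'I_n,
        if i.+1 == n then
          exists2 s, es i = expr_of_term s & tsubst g s = qterm X d'
        else qualified (es i) d'
  | _ => True
  end.

Definition cqualified (c : tconstr) (d : D) : Prop :=
  forall i, qualified (c_args c i) d.

Lemma qualified_term (t : tterm) d : qualified (expr_of_term t) d.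
Proof. by elim: t. Qed.

Lemma der_qvars Th e tr : trExpr X e tr ->
  der (map (csubst Th) (tr_omega tr)) ->
  {in tr_qvars tr, forall w, der (qVal (Th (inW w)))}.
Proof.
elim=> {e tr} [|x|u|n c es rs _ IH|n p es rs _ IH|n f es rs w _ _] //=.
- rewrite map_bigcat => /derivable_all_bigcat H w /mem_bigcat[i]; exact: IH.
- rewrite map_bigcat => /derivable_all_bigcat H w /mem_bigcat[i]; exact: IH.
rewrite !map_cat map_qVal => /derivable_all_cat[_ /derivable_all_cat[H _]] v.
by rewrite inE => /eqP ->.
Qed.

Lemma der_cqvars Th c tr : trConstr X c tr ->
  der (map (csubst Th) (tr_omega tr)) ->
  {in tr_qvars tr, forall w, der (qVal (Th (inW w)))}.
Proof.
case/trConstr_inv=> rs T -> /=.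
rewrite map_bigcat => /derivable_all_bigcat H w /mem_bigcat[i].
exact: der_qvars (T i) (H i) w.
Qed.

(** For nested calls the bounds come from the constraints of the transform, which place the variable
    of a call below the top-level variables of its arguments. *)
Lemma qualified_transform Th e tr : trExpr X e tr -> forall d,
  d != \bot -> der (map (csubst Th) (tr_omega tr)) ->
  {in tr_qvars tr, forall w,
    exists2 d', d <= d' & tsubst g (Th (inW w)) = qterm X d'} ->
  qualified (esubst Th (tr_obj tr)) d.
Proof.
elim=> {e tr} [|x|u|n c es rs _ IH|n p es rs _ IH|n f es rs w T IH] d nd /=.
- by [].
- by move=> _ _; apply: qualified_term.
- by [].
- rewrite map_bigcat => /derivable_all_bigcat H val i; apply: IH => // w wi.
  by apply: val; apply/mem_bigcat; exists i.
- rewrite map_bigcat => /derivable_all_bigcat H val i; apply: IH => // w wi.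
  by apply: val; apply/mem_bigcat; exists i.
rewrite !map_cat map_qLes map_bigcat.
move=> /derivable_all_cat[/derivable_all_bigcat HO].
move=> /derivable_all_cat[_ /derivable_all_flatten Hle] val.
have [d' dd' ew] := val w (mem_head _ _); exists d' => // i.
have nd' := le_neq0 dd' nd.
rewrite /snoc; case: unliftP => [j ->|->]; last first.
  by rewrite /= eqxx; exists (Th (inW w)).
have -> : ((lift ord_max j).+1 == n.+1) = false.
  by apply/negbTE; rewrite lift_max eqSS neq_ltn ltn_ord.
apply: IH => // v vj.
have [e ne ev] := der_qVal_sound sg (der_qvars (T j) (HO j) vj).
exists e => //; apply: (der_qLe_sound hD sg _ nd' ne ew ev).
by apply: Hle; apply/mem_bigcat; exists j.
Qed.

Lemma cqualified_transform Th c tr d : trConstr X c tr ->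
  d != \bot -> der (map (csubst Th) (tr_omega tr)) ->
  {in tr_qvars tr, forall w,
    exists2 d', d <= d' & tsubst g (Th (inW w)) = qterm X d'} ->
  cqualified (csubst Th (tr_obj tr)) d.
Proof.
case/trConstr_inv=> rs T -> nd /=.
rewrite map_bigcat => /derivable_all_bigcat H val i /=.
apply: (qualified_transform (T i)) => // w wi.
by apply: val; apply/mem_bigcat; exists i.
Qed.

(** The value [d] is universally quantified since the meets at which body and conditions are needed
    are known only when the rule is applied. *)
Definition backward (psi : stmt S (basic C) (DFT F) tvar) : Prop :=
  forall d, d != \bot ->
  match psi with
  | Prod e t => qualified e d ->
      qcrwl circ P Pi (Prod (erase e) (tsubst erase_var t)) d
  | Con c => cqualified c d -> qcrwl circ P Pi (Con (erase_constr c)) d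
  end.

Lemma backward_rule R R' : trRule X R R' -> q_att R != \bot -> P R ->
  forall Th (es : 'I_(r_ar R') -> texpr) t,
  (forall i, crwl P' Pi' (Prod (es i) (tsubst Th (r_lhs R' i)))) ->
  (forall i, backward (Prod (es i) (tsubst Th (r_lhs R' i)))) ->
  backward (Prod (esubst Th (r_rhs R')) t) ->
  der (map (csubst Th) (r_conds R')) ->
  (forall c, List.In c (map (csubst Th) (r_conds R')) -> backward (Con c)) ->
  backward (Prod (EDef (r_fun R') es) t).
Proof.
case=> {R R'} n f lhs a rhs m deltas w tr trs T Ts _ /= na PR Th es t.
move=> Hes IHes IHr Hc IHc d nd [d0 dd0 qes].
have nd0 := le_neq0 dd0 nd.
move: Hc; rewrite !map_cat map_qVal map_bigcat => /derivable_all_cat[Hw].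
move=> /derivable_all_cat[HO /derivable_all_cat[Hfam /derivable_all_bigcat Hcs]].
have {Hcs} Hcs j := Hcs j.
have Hcs1 j : der (map (csubst Th) (tr_omega (trs j))).
  by have := Hcs j; rewrite !map_cat => /derivable_all_cat[].
have Hcs2 j : der (map (csubst Th) (qFamily X F w a (tr_qvars (trs j)))).
  by have := Hcs j; rewrite !map_cat => /derivable_all_cat[_ /derivable_all_cat[]].
(* The parameter [w] may receive only an approximation of the actual argument; as [qVal] makes it
   represent a qualification too, incomparability of these values gives equality. *)
have ew : tsubst g (Th (inW w)) = qterm X d0.
  have := qes ord_max; rewrite eqxx => -[s es_s gs].
  have := Hes ord_max; rewrite snoc_max es_s => /(crwl_term_sound sg).
  have [d1 nd1 e1] := der_qVal_sound sg Hw.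
  by rewrite gs e1 => /(qterm_tle hD nd1 nd0) <-.
have [|d1 [nd1 le1 val1]] := der_qFamily_sound hD sg na nd0 Hfam ew.
  by move=> v vs; apply: (der_qVal_sound sg); apply: der_qvars T HO _ vs.
have /fin_all_exists[ds Hds] j : exists d', [/\ d' != \bot, d0 <= circ a d' &
    {in tr_qvars (trs j), forall v,
      exists2 e, d' <= e & tsubst g (Th (inW v)) = qterm X e}].
  apply: (der_qFamily_sound hD sg na nd0 (Hcs2 j) ew) => v vs.
  by apply: (der_qVal_sound sg); apply: der_cqvars (Ts j) (Hcs1 j) _ vs.
(* The source instance of the rule: the target one with qualification variables erased from its
   values. *)
pose th x := tsubst erase_var (Th (inV x)).
apply: (qcrwl_def (R := qrule_subst th (QRule f lhs a rhs deltas))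
          (ds := fun=> d0) (d0 := d1) (ds' := ds)) => //=.
- by exists (QRule f lhs a rhs deltas) => //; exists th.
- move=> i; have := IHes (lift ord_max i) d0 nd0.
  rewrite snoc_lift /trename !tsubst_comp; apply.
  have := qes (lift ord_max i); rewrite ifF //.
  by rewrite lift_max eqSS; apply/negbTE; rewrite neq_ltn ltn_ord.
- have := IHr d1 nd1; rewrite (erase_transform _ T); apply.
  exact: qualified_transform T _ nd1 HO val1.
- move=> j; have [nj _ valj] := Hds j.
  rewrite -(erase_constr_transform _ (Ts j)); apply: IHc => //.
    rewrite !map_cat map_bigcat; do 3!(apply/In_cat; right).
    apply/In_bigcat; exists j; rewrite !map_cat.
    by do 2!(apply/In_cat; right); left.
  exact: cqualified_transform (Ts j) nj (Hcs1 j) valj.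
- exact: le_trans dd0 le1.
by move=> j; apply: le_trans dd0 _; case: (Hds j).
Qed.

(** Transfers entailments from the renamed constraints to [Pi], with all terms erased. *)
Lemma gsol_erase h : gsol Pi h ->
  gsol Pi' (fun x => tsubst h (erase_var x)).
Proof. by move=> sh; apply/gsol_crename. Qed.

Lemma crwl_backward psi : crwl P' Pi' psi -> backward psi.
Proof.
have sat : ~ Unsat Pi' by move=> /Unsat_gsol; apply; exists g.
elim=> {psi} [psi _ [/sat//|[e ->]]|v _ hv|n c es ts _ _ IH|
  R es t _ [R0 PR0 [Th ER]] Hes IHes _ IHr Hc IHc|
  n p es ts v _ _ IH hv ent|n p es ts v _ _ IH hv ent] d nd /=.
- by move=> _; apply: qcrwl_bot.
- rewrite erase_term => _; case: v hv => // [[x|x]|u] _ /=.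
  + exact: (qcrwl_refl _ _ _ (v := TVar x)).
  + exact: qcrwl_bot.
  + exact: (qcrwl_refl _ _ _ (v := TBas u)).
- by move=> q; apply: qcrwl_con => // i; apply: IH.
- subst R; have [R PR tR] := hP' PR0; have [_ na _ _ _] := hP PR.
  exact: (backward_rule tR na PR Hes IHes IHr Hc IHc).
(* Erasure destroys simplicity only if [v] is a qualification variable; the statement then has
   target bot. *)
- move=> q; case hb: (is_simple (tsubst erase_var v)); last first.
    by case: v {ent} hv hb => // -[x|x] // _ _; apply: qcrwl_bot.
  apply: (qcrwl_prim (ts := fun i => tsubst erase_var (ts i))) => //.
    by move=> i; apply: IH.
  apply/entails_prod_gsol => h sh.
  have := (entails_prod_gsol _ _ _ _).1 ent _ (gsol_erase sh).
  rewrite -tsubst_comp; congr interp.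
  by apply: functional_extensionality => i; rewrite tsubst_comp.
move=> q; have H h : gsol Pi h -> ctrue (csubst h
    (prim_app p (fun i => tsubst erase_var (ts i)) (tsubst erase_var v))).
  move=> sh; have := (entails_gsol _ _).1 ent _ (gsol_erase sh).
  rewrite /csubst /= -tsubst_comp; congr (ctrue (Constr _ _ _)).
  by apply: functional_extensionality => i; rewrite !esubst_term tsubst_comp.
rewrite /erase_constr /=.
apply: (qcrwl_constr (ts := fun i => tsubst erase_var (ts i))) => //.
- by move=> i; apply: IH.
(* Here [v] cannot be a qualification variable: the erased constraint is true under this solution,
   so its right-hand side is total. *)
- have sg' : gsol Pi (fun x => g (inV x)) by apply/gsol_crename.
  by have [] := H _ sg'; case: (v) hv => // -[x|x].
exact/entails_gsol.
Qed.

End Backward.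

(** * Solutions of goals and of transformed goals *)

Theorem theorem4
  (disp : Order.disp_t) (D : tbLatticeType disp) (circ : D -> D -> D)
  (hD : is_qdomain circ)
  (S : signature) (C : cdomain S) (X : expressible circ C)
  (F : nat -> Type)
  (P : qrule D C F svar -> Prop) (hP : qprogram_wf P)
  (P' : crule C (DFT F) tvar -> Prop) (hP' : trProgram X P P')
  (G : goal D C F) (hG : goal_wf G)
  (G' : seq (constr S (basic C) (DFT F) tvar)) (new : seq qvar)
  (hG' : trGoal X G G' new)
  (sigma : subst S (basic C) svar)
  (mu : subst S (basic C) qvar) (hmu : dvaluation X mu)
  (hmuG : forall i, vdom mu (g_var G i))
  (hmu_new : forall w, w \in new -> ~~ vdom mu w)
  (Pi : seq (prim_constr C svar))
  (hPi : all (fun c => atomic c) Pi)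
  (* If Pi is unsatisfiable, every statement with condition Pi is trivially
     derivable in the target logic, the threshold constraints included. *)
  (hunsat : Unsat Pi -> meets_thresholds X G mu) :
  qsol X P G sigma mu Pi <->
  exists rho : subst S (basic C) qvar,
    [/\ dvaluation X rho, vdom rho =i new
      & csol P' G' (subst_sum sigma (subst_union mu rho))
             [seq crename inV c | c <- Pi]].
Proof.
have [_ Ginj nthr] := hG.
have hPi' : all (fun c => atomic c)
    [seq crename inV c | c <- Pi : seq (constr S (basic C) noDF svar)].
  rewrite all_map; apply: sub_all hPi => c.
  by rewrite /= /atomic /= is_simple_trename.
case: hG' hmu_new => tds T U hmu_new.
set Pi' := [seq _ | _ <- _] in hPi' *.
have derE th (G0 : seq (constr S (basic C) (DFT F) tvar)) :
    csol P' G0 th Pi' <-> derivable_all P' Pi' (map (csubst th) G0).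
  split=> [[_ H] c /In_map[c0 /H Hc0 ->] //|H]; split=> // c Gc.
  by apply: H; apply/In_map; exists c.
have inVE rho x : tsubst (@erase_var S C)
    (subst_sum sigma (subst_union mu rho) (inV x)) = sigma x.
  by rewrite /= /trename tsubst_comp tsubst_id.
have inWE rho i d : mu (g_var G i) = of_gterm (qterm X d) ->
    subst_sum sigma (subst_union mu rho) (inW (g_var G i)) = dv X d.
  by move=> e; rewrite /= /subst_union hmuG e /trename tsubst_of_gterm.
split=> [[_ _ Hi]|[rho [_ _ /derE]]].
  have /fin_all_exists[ds Hds] := Hi.
  move: U; rewrite cat_uniq => /and3P[_ /hasPn disj U].
  have /fin_all_exists2[rs nrs Hrs] i :
      exists2 r, forall w, r w != \bot &
        realizes P' Pi (inst X sigma r) r (tds i) (ds i)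
                 (Con (csubst (inst X sigma r) (tr_obj (tds i)))).
    have [_ _ _ Hq] := Hds i.
    apply: (forward_constr _ (T i) ((uniq_bigcat U).1 i)).
    exact: (qcrwl_forward hD hP'.1 Hq).
  (* One function [r] is to describe both [mu] on the goal variables and [rho] on the new ones; the
     default [\top] is arbitrary. *)
  pose r0 w := if [pick i | g_var G i == w] is Some i then ds i else \top.
  have [r [rE r0E]] := join_functions rs r0 U.
  have rW i : r (g_var G i) = ds i.
    rewrite r0E /r0; last first.
      apply/negP => /disj /negP; apply; apply/mem_bigcat; exists i.
      exact: mem_head.
    by case: pickP => [j /eqP/Ginj->//|/(_ i)]; rewrite eqxx.
  pose rho w := if w \in bigcat (fun i => tr_new (tds i))
                then of_gterm (qterm X (r w)) else TVar w.
  have rho_dom : vdom rho =i bigcat (fun i => tr_new (tds i)).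
    move=> w; rewrite unfold_in /rho; case: ifP => _; last by rewrite eqxx.
    by case: (qterm X (r w)) => // -[].
  exists rho; split=> //.
    move=> w wrho; have wn : w \in bigcat (fun i => tr_new (tds i)).
      by rewrite -rho_dom.
    exists (r w); last by rewrite /rho wn.
    by case/mem_bigcat: wn => i wi; rewrite (rE i).
  apply/derE; rewrite map_bigcat; apply/derivable_all_bigcat => i.
  have inW_new w : w \in tr_new (tds i) ->
      subst_sum sigma (subst_union mu rho) (inW w) = dv X (r w).
    move=> wi; have wn : w \in bigcat (fun i => tr_new (tds i)).
      by apply/mem_bigcat; exists i.
    rewrite /= /subst_union (negbTE (hmu_new w wn)) /rho wn.
    by rewrite /trename tsubst_of_gterm.
  have [nd mud thrd _] := Hds i.
  have agree_rs : {in tr_new (tds i), rs i =1 r} by move=> w wi; rewrite (rE i).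
  have [O le Hc] := realizes_constr (T i) agree_rs (Hrs i).
  have [EO EC] := trConstr_agree (T i)
    (fun w wi => esym (inW_new w wi) : inst X sigma r (inW w) = _).
  rewrite !map_cat -EO; apply/derivable_all_cat; split=> //.
  apply/derivable_all_cat; split.
    by rewrite map_qVal [tsubst _ _](inWE _ _ _ mud); apply: der_qVal.
  apply/derivable_all_cat; split.
    apply: (der_qFamily hD P' _ (r := r)); rewrite ?rW ?lex1 //.
      move=> w; rewrite inE => /predU1P[->|wq]; first by rewrite rW; apply: inWE.
      by apply: inW_new; apply: trConstr_qvars_new (T i) _ wq.
    by move=> w wq; rewrite (top_circ hD) le.
  apply/derivable_all_cat; split.
    rewrite map_qBound !tsubst_of_gterm [tsubst _ (wv _ _)](inWE _ _ _ mud).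
    exact: (der_qLe hD).
  by apply/derivable_all1; rewrite -EC.
rewrite map_bigcat => /derivable_all_bigcat H; split=> // i.
have := H i; rewrite !map_cat => /derivable_all_cat[HO].
move=> /derivable_all_cat[_ /derivable_all_cat[Hfam]].
move=> /derivable_all_cat[Hthr /derivable_all1 Hc].
have [d nd mud] := hmu _ (hmuG i).
(* With no solution of [Pi] to read terms under, the thresholds come from [hunsat] and the source
   statement is trivial. *)
have [U0|] := classic (Unsat Pi).
  have [e mue thre] := hunsat U0 i; have ne := le_neq0 thre (nthr i).
  exists e; split=> //; apply: QTI => //; last by left.
  have /= [+ _] := crwl_inv Hc.
  case/trConstr_inv: (T i) => rs _ ->.
  by rewrite /atomic /= trename_subst_sum is_simple_trename.
rewrite -Unsat_crename Unsat_gsol => /NNPP[g sg].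
have ew : tsubst g (subst_sum sigma (subst_union mu rho) (inW (g_var G i))) =
    qterm X d.
  by rewrite (inWE _ _ _ mud); apply: tsubst_of_gtermK.
exists d; split=> //.
  have E th b : tsubst th (dv X b) = dv X b :> term S (basic C) tvar.
    exact: tsubst_of_gterm.
  move: Hthr; rewrite map_qBound !E => Hthr.
  apply: (der_qLe_sound hD sg Hthr (nthr i) nd _ ew).
  exact: tsubst_of_gtermK.
have nt : (\top : D) != \bot by apply: le_neq0 nd; apply: lex1.
(* With [\top] as attenuation the bound is [d <= d1], so [d] itself bounds the top-level variables
   of the constraint. *)
have [|d1 [nd1 le1 val1]] := der_qFamily_sound hD sg nt nd Hfam ew.
  by move=> v vq; apply: (der_qVal_sound sg); apply: der_cqvars (T i) HO _ vq.
have := crwl_backward hD hP hP'.2 sg Hc nd.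
rewrite (erase_constr_transform _ (T i)).
have -> : (fun x => tsubst (@erase_var S C)
    (subst_sum sigma (subst_union mu rho) (inV x))) = sigma.
  by apply: functional_extensionality => x; apply: inVE.
apply; apply: (cqualified_transform hD sg (T i) nd HO) => v vq.
have [e le_e ev] := val1 v vq.
by exists e => //; apply: le_trans le_e; rewrite -[leRHS](top_circ hD).
Qed.
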